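(* Let $0\le\beta<1/2$, and set $\overline L:=[|\log p|/\log 2]$, $\overline M:=[Np|\log p|/(\log 2)^2]$. Let $P^{\mathcal R-\mathcal P}_{N,\overline M,\overline L}$ be the probability distribution on $N\times\overline M$ binary matrices $C_{N,\overline M}=(c_{i,a})$ under which the rows are independent and each row is uniformly distributed among the $\binom{\overline M}{\overline L}$ binary vectors with exactly $\overline L$ ones. Then $$\lim_{N\to\infty\vert\beta}\sum_{C_{N,\overline M}}P^{\mathcal R-\mathcal P}_{N,\overline M,\overline L}(C_{N,\overline M})\,\frac{T_{\overline M,C_{N,\overline M},p}}{Np|\log p|}=\frac{1}{(\log 2)^2}.$$
   Context: Probabilistic group testing with two-stage algorithms. For an integer $N\ge1$ and $p\in(0,1)$, a configuration $X=(x_1,\dots,x_N)\in\{0,1\}^N$ is drawn from $\mu_p(X)=\prod_{i} p^{x_i}(1-p)^{1-x_i}$. A first stage with $M$ tests is an $N\times M$ binary matrix $C_{N,M}=(c_{i,a})$; variable $i$ belongs to test $a$ iff $c_{i,a}=1$. Test outcome $T_a=0$ if $c_{i,a}x_i=0$ for all $i$, else $T_a=1$. Variable $i$ is a sure zero if some $a$ has $c_{i,a}=1$ and $T_a=0$; it is a sure one if $x_i=1$ and some $a$ with $c_{i,a}=1$ has every other $j$ with $c_{j,a}=1$ a sure zero. $\mathcal U_0$ is the set of $i$ with $x_i=0$ not sure zeros, $\mathcal U_1$ the set of $i$ with $x_i=1$ not sure ones. $T_{M,C_{N,M},p}:=M+\sum_X\mu_p(X)(|\mathcal U_0|+|\mathcal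 U_1|)$. $[x]$ denotes the integer part, $\log$ the natural logarithm. For $\beta>0$, $\lim_{N\to\infty\vert\beta}f(N,p):=\lim_{N\to\infty}f(N,N^{-\beta})$; for $\beta=0$, $\lim_{N\to\infty\vert 0}f(N,p):=\lim_{p\to0}\lim_{N\to\infty}f(N,p)$. *)

(* Defs.v *)
From HB Require Import structures.
From mathcomp Require Import all_boot all_order all_algebra.
From mathcomp Require Import all_classical all_reals all_analysis.
Set Implicit Arguments. Unset Strict Implicit. Unset Printing Implicit Defensive.
Import Order.TTheory GRing.Theory Num.Theory.
Import numFieldNormedType.Exports.
Local Open Scope ring_scope.

Section GroupTesting.
Variable R : realType.

Definition config (N : nat) := {ffun 'I_N -> bool}.
Definition design (N M : nat) := {ffun 'I_N -> {ffun 'I_M -> bool}}.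

Definition mu (N : nat) (p : R) (X : config N) : R :=
  \prod_(i < N) (if X i then p else 1 - p).

Definition test_out N M (C : design N M) (X : config N) (a : 'I_M) : bool :=
  [exists i : 'I_N, C i a && X i].

Definition sure_zero N M (C : design N M) (X : config N) (i : 'I_N) : bool :=
  [exists a : 'I_M, C i a && ~~ test_out C X a].

Definition sure_one N M (C : design N M) (X : config N) (i : 'I_N) : bool :=
  X i && [exists a : 'I_M, C i a &&
           [forall j : 'I_N, ((j != i) && C j a) ==> sure_zero C X j]].

Definition U0 N M (C : design N M) (X : config N) : {set 'I_N} :=
  [set i | ~~ X i & ~~ sure_zero C X i].
Definition U1 N M (C : design N M) (X : config N) : {set 'I_N} :=
  [set i | X i & ~~ sure_one C X i].

Definition Tcost N M (C : design N M) (p : R) : R :=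
  M%:R + \sum_(X : config N) mu p X * (#|U0 C X| + #|U1 C X|)%:R.

Definition Lbar (p : R) : nat := Num.truncn (`|ln p| / ln 2).
Definition Mbar (N : nat) (p : R) : nat :=
  Num.truncn (N%:R * p * `|ln p| / (ln 2) ^+ 2).

Definition PRP N M (L : nat) (C : design N M) : R :=
  \prod_(i < N) (if #|[set a | C i a]| == L then ('C(M, L))%:R^-1 else 0).

Definition avg_cost (N : nat) (p : R) : R :=
  \sum_(C : design N (Mbar N p)) PRP (Lbar p) C * Tcost C p
     / (N%:R * p * `|ln p|).

End GroupTesting.

(* Main.v *)
(** Let [V] be the set of tests with positive outcome. Given the positive rows of
    the design, the rows of the negative items are still
    independent uniform draws of [L] tests, so a negative item stays
    undetermined with probability ['C(#|V|, L) / 'C(M, L)], and a first and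
    second moment computation shows that [#|V| / M] concentrates at
    [1 - (1 - p * L / M) ^+ N], which is close to [1/2] for the prescribed
    [L] and [M]. Hence a negative item is undetermined with probability
    [O(2 ^- L) = O(p)]; a Chebyshev deviation of order [1/L] costs an extra
    [O(|ln p| / (N * p ^+ 2))], which is where [beta < 1/2] enters. The
    undetermined positive items are at most the [N * p] positive ones on
    average, so both kinds are negligible against [N * p * |ln p|] and only the
    [M] first-stage tests count.

    For [beta = 0] the inner limit in [N] must moreover be shown to exist. For
    the positive items this goes by inclusion-exclusion over the tests of the
    item: given the positive rows, the probability that all other items in a
    set [B] of its tests are sure zeros is a product over the negative items,
    and concentration of [#|V| / M] makes it converge. *)

Require Import Defs.
From HB Require Import structures.
From mathcomp Require Import all_boot all_order all_algebra.
From mathcomp Require Import all_classical all_reals all_analysis.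
From mathcomp Require Import finset ring lra zify.
Import Order.TTheory GRing.Theory Num.Theory.
Import numFieldNormedType.Exports.
Set Implicit Arguments. Unset Strict Implicit. Unset Printing Implicit Defensive.
Local Open Scope ring_scope.

(** * Finite expectations *)

Section ProductWeights.
Variables (R : comPzRingType) (I T : finType).

Definition mix (Z : pred I) (f g : {ffun I -> T}) : {ffun I -> T} :=
  [ffun i => if Z i then g i else f i].

(* Two independent copies stay independent and identically distributed after
   exchanging their coordinates in [Z]. *)
Lemma sum_prod_mix (w : T -> R) (Z : pred I) (F : {ffun I -> T} -> R) :
  \sum_t w t = 1 ->
  \sum_(f : {ffun I -> T}) (\prod_i w (f i)) * F f =
  \sum_(f : {ffun I -> T}) (\prod_i w (f i)) *
    \sum_(g : {ffun I -> T}) (\prod_i w (g i)) * F (mix Z f g).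
Proof.
move=> w1.
have W1 : \sum_(g : {ffun I -> T}) \prod_i w (g i) = 1.
  by rewrite -(bigA_distr_bigA (fun=> w)) big1.
transitivity (\sum_(z : {ffun I -> T} * {ffun I -> T})
    ((\prod_i w (z.1 i)) * (\prod_i w (z.2 i))) * F z.1).
  rewrite -(pair_bigA _ (fun f g : {ffun I -> T} =>
    (\prod_i w (f i)) * (\prod_i w (g i)) * F f)) /=.
  by apply: eq_bigr => f _; rewrite -mulr_suml -mulr_sumr W1 mulr1.
pose swap (z : {ffun I -> T} * {ffun I -> T}) :=
  (mix Z z.1 z.2, mix Z z.2 z.1).
have swapK : involutive swap.
  by case=> f g; congr (_, _); apply/ffunP => i; rewrite !ffunE /=; case: (Z i).
rewrite (reindex_inj (inv_inj swapK)) /=.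
rewrite -(pair_bigA _ (fun f g => ((\prod_i w (mix Z f g i)) *
    (\prod_i w (mix Z g f i))) * F (mix Z f g))) /=.
apply: eq_bigr => f _; rewrite mulr_sumr; apply: eq_bigr => g _.
rewrite mulrA -!big_split /=; congr (_ * _); apply: eq_bigr => i _.
by rewrite !ffunE; case: (Z i) => //; rewrite mulrC.
Qed.

End ProductWeights.

Section Expectation.
Variables (R : realType) (T : finType) (w : T -> R).
Hypotheses (w_ge0 : forall t, 0 <= w t) (w_sum1 : \sum_t w t = 1).

Definition expect (F : T -> R) : R := \sum_t w t * F t.

Lemma eq_expect F G : F =1 G -> expect F = expect G.
Proof. by move=> FG; apply: eq_bigr => t _; rewrite FG. Qed.

Lemma expect_cst c : expect (fun=> c) = c.
Proof. by rewrite /expect -mulr_suml w_sum1 mul1r. Qed.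

Lemma expectD F G : expect (fun t => F t + G t) = expect F + expect G.
Proof. by rewrite /expect -big_split; apply: eq_bigr => t _; rewrite mulrDr. Qed.

Lemma expectZ c F : expect (fun t => c * F t) = c * expect F.
Proof. by rewrite /expect mulr_sumr; apply: eq_bigr => t _; rewrite mulrCA. Qed.

Lemma expectB F G : expect (fun t => F t - G t) = expect F - expect G.
Proof.
rewrite -mulN1r -expectZ -expectD; apply: eq_expect => t.
by rewrite mulN1r.
Qed.

Lemma expect_sum (J : Type) (r : seq J) (P : pred J) (F : J -> T -> R) :
  expect (fun t => \sum_(j <- r | P j) F j t) =
  \sum_(j <- r | P j) expect (F j).
Proof.
by rewrite /expect exchange_big; apply: eq_bigr => t _; rewrite mulr_sumr.
Qed.

(** Points of zero weight drop out of both sums; under the joint law this lets a comparison assume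
    that every row has exactly [L] ones. *)
Lemma ler_expect F G : (forall t, w t != 0 -> F t <= G t) ->
  expect F <= expect G.
Proof.
move=> FG; apply: ler_sum => t _.
have [->|wt0] := eqVneq (w t) 0; first by rewrite !mul0r.
by rewrite ler_wpM2l ?FG.
Qed.

Lemma expect_ge0 F : (forall t, 0 <= F t) -> 0 <= expect F.
Proof. by move=> F0; apply: sumr_ge0 => t _; rewrite mulr_ge0. Qed.

Lemma ler_norm_expect F : `|expect F| <= expect (fun t => `|F t|).
Proof.
apply: le_trans (ler_norm_sum _ _ _) _; apply: ler_sum => t _.
by rewrite normrM ger0_norm.
Qed.

(** Pointwise, [e * |F| <= e ^ 2 + F ^ 2]. A variance bound thus controls a mean absolute deviation,
    with [e] left free to be tuned. *)
Lemma expect_norm_le_sqr e F : 0 < e ->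
  expect (fun t => `|F t|) <= e + e^-1 * expect (fun t => F t ^+ 2).
Proof.
move=> e0; rewrite -[X in X + _]expect_cst -expectZ -expectD.
apply: ler_expect => t _.
rewrite -(ler_pM2l e0) mulrDr mulVKf ?gt_eqF// -real_normK ?num_real//.
by have := sqr_ge0 (`|F t| - e); have := normr_ge0 (F t); nra.
Qed.

End Expectation.

Lemma sum_subset_by_card (R : pzRingType) (T : finType) (A : {set T}) (f : nat -> R) :
  \sum_(B : {set T} | B \subset A) f #|B| =
  \sum_(k < #|A|.+1) f k *+ 'C(#|A|, k).
Proof.
rewrite (partition_big (fun B : {set T} => inord #|B| : 'I_#|A|.+1) xpredT) //=.
apply: eq_bigr => k _; rewrite -(cards_draws A k) -sumr_const.
apply: eq_big => [B|B /andP[BA /eqP <-]].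
  rewrite inE; case BA : (B \subset A) => //=.
  by rewrite -val_eqE /= inordK // ltnS subset_leq_card.
by rewrite inordK // ltnS subset_leq_card.
Qed.

Lemma ler_dist_prod (R : realDomainType) (I : Type) (r : seq I) (P : pred I)
    (F G : I -> R) :
  (forall i, 0 <= F i <= 1) -> (forall i, 0 <= G i <= 1) ->
  `|\prod_(i <- r | P i) F i - \prod_(i <- r | P i) G i| <=
  \sum_(i <- r | P i) `|F i - G i|.
Proof.
(* The induction also carries that both partial products stay in [0,1], so that each exchanged
   factor costs only its own difference. *)
move=> F01 G01; pose K (x y z : R) := [/\ 0 <= x <= 1, 0 <= y <= 1 & `|x - y| <= z].
suff [] : K (\prod_(i <- r | P i) F i) (\prod_(i <- r | P i) G i)
    (\sum_(i <- r | P i) `|F i - G i|) by [].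
apply: big_rec3 => [|i x y z _ [x01 y01 xyz]]; first by rewrite /K subrr normr0 ler01 lexx.
have /andP[f0 f1] := F01 i; have /andP[g0 g1] := G01 i.
move: x01 y01 => /andP[x0 x1] /andP[y0 y1].
split; rewrite ?mulr_ge0 ?mulr_ile1 //.
have -> : F i * x - G i * y = F i * (x - y) + (F i - G i) * y by ring.
apply: le_trans (ler_normD _ _) _; rewrite addrC; apply: lerD.
  by rewrite normrM (ger0_norm y0) ler_piMr.
by rewrite normrM (ger0_norm f0) (le_trans _ xyz)// ler_piMl.
Qed.

(** * Rows of the design *)

Section Rows.
Variables (R : realType) (M L : nat).
Hypothesis LM : (L <= M)%N.
Local Notation row := {ffun 'I_M -> bool}.

Definition support_row (s : row) : {set 'I_M} := [set a | s a].

Definition row_weight (s : row) : R :=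
  if #|[set a | s a]| == L then ('C(M, L))%:R^-1 else 0.

(** Probability that a uniform [L]-subset of the [M] tests lies inside a given set of [v] tests. *)
Definition draw_ratio (v : nat) : R := ('C(v, L))%:R / ('C(M, L))%:R.

Lemma row_weight_ge0 s : 0 <= row_weight s.
Proof. by rewrite /row_weight; case: ifP; rewrite ?invr_ge0 ?ler0n. Qed.

Lemma row_weight_neq0 s : row_weight s != 0 -> #|support_row s| = L.
Proof. by rewrite /row_weight /support_row; case: ifP => [/eqP //|_ /eqP]. Qed.

(** Rows correspond bijectively to their supports, so the sum counts the [L]-subsets of [V]. *)
Lemma sum_row_weight_sub (V : {set 'I_M}) :
  \sum_s row_weight s * (support_row s \subset V)%:R = draw_ratio #|V|.
Proof.
rewrite /draw_ratio -cards_draws mulrC mulr_natr -sumr_const.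
pose h (A : {set 'I_M}) : row := [ffun a => a \in A].
have hK : cancel support_row h by move=> s; apply/ffunP => a; rewrite ffunE inE.
have Kh : cancel h support_row by move=> A; apply/setP => a; rewrite inE ffunE.
rewrite (reindex h) /=; last by exists support_row => ? _.
rewrite [RHS]big_mkcond; apply: eq_bigr => A _.
rewrite Kh inE /row_weight -/(support_row _) Kh.
by case: (A \subset V); case: (#|A| == L); rewrite ?mulr1 ?mulr0.
Qed.

Lemma draw_ratio_full : draw_ratio M = 1.
Proof. by rewrite /draw_ratio divff// pnatr_eq0 -lt0n bin_gt0. Qed.

Lemma sum_row_weight : \sum_s row_weight s = 1.
Proof.
have := sum_row_weight_sub setT; rewrite cardsT card_ord draw_ratio_full => <-.
by apply: eq_bigr => s _; rewrite subsetT mulr1.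
Qed.

Lemma draw_ratio_ge0 v : 0 <= draw_ratio v.
Proof. by rewrite divr_ge0. Qed.

Lemma leq_draw_ratio u v : (u <= v)%N -> draw_ratio u <= draw_ratio v.
Proof.
by move=> uv; rewrite ler_wpM2r ?invr_ge0 ?ler0n// ler_nat leq_bin2l.
Qed.

Lemma draw_ratio_le1 v : (v <= M)%N -> draw_ratio v <= 1.
Proof. by rewrite -draw_ratio_full; apply: leq_draw_ratio. Qed.

Lemma sum_row_weight_disjoint (B : {set 'I_M}) :
  \sum_s row_weight s * [disjoint support_row s & B]%:R = draw_ratio (M - #|B|).
Proof.
have -> : (M - #|B| = #|~: B|)%N by rewrite [in RHS]cardsCs setCK card_ord.
rewrite -sum_row_weight_sub; apply: eq_bigr => s _; congr (_ * _%:R).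
by rewrite disjoints_subset.
Qed.

(** The complementary event, lying inside [V] and meeting [B], is lying inside [V] but not inside
    [V :\: B]. *)
Lemma sum_row_weight_miss (B V : {set 'I_M}) : B \subset V ->
  \sum_s row_weight s *
    (~~ ((support_row s \subset V) && ~~ [disjoint support_row s & B]))%:R =
  1 - (draw_ratio #|V| - draw_ratio (#|V| - #|B|)).
Proof.
move=> BV; have -> : (#|V| - #|B| = #|V :\: B|)%N.
  by rewrite cardsD (setIidPr BV).
rewrite -[in RHS]sum_row_weight -!sum_row_weight_sub -!sumrB; apply: eq_bigr => s _.
rewrite subsetD.
by case: (_ \subset V); case: [disjoint _ & _]; rewrite /= ?mulr1 ?mulr0; ring.
Qed.

End Rows.

(** * Covered tests *)

Section Model.
Variables (R : realType) (N M L : nat) (p : R).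
Hypotheses (LM : (L <= M)%N) (p01 : 0 <= p <= 1).
Local Notation row := {ffun 'I_M -> bool}.
Local Notation u := (row_weight R L).
Local Notation rho := (draw_ratio R M L).

Definition covered (C : design N M) (X : config N) : {set 'I_M} :=
  [set a | test_out C X a].

Definition joint_weight (z : config N * design N M) : R :=
  mu p z.1 * PRP R L z.2.

Local Notation Ex := (expect joint_weight).

Lemma sum_PRP_prod (G : 'I_N -> row -> R) :
  \sum_(C : design N M) PRP R L C * (\prod_i G i (C i)) =
  \prod_i \sum_s u s * G i s.
Proof.
by rewrite bigA_distr_bigA; apply: eq_bigr => C _; rewrite -big_split.
Qed.

(** The pairs formed by the status of an item and its row are independent across items. *)
Lemma expect_prod (G : 'I_N -> bool -> row -> R) :
  Ex (fun z => \prod_i G i (z.1 i) (z.2 i)) =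
  \prod_i (p * (\sum_s u s * G i true s) +
           (1 - p) * \sum_s u s * G i false s).
Proof.
rewrite /expect -(pair_bigA _ (fun X C =>
   joint_weight (X, C) * \prod_i G i (X i) (C i))) /=.
transitivity (\sum_(X : config N) \prod_i ((if X i then p else 1 - p) *
   \sum_s u s * G i (X i) s)).
  apply: eq_bigr => X _; rewrite big_split /= -sum_PRP_prod mulr_sumr.
  by apply: eq_bigr => C _; rewrite /joint_weight /= mulrA.
rewrite -(bigA_distr_bigA (fun i (x : bool) => (if x then p else 1 - p) *
   \sum_s u s * G i x s)).
by apply: eq_bigr => i _; rewrite big_bool.
Qed.

Lemma joint_weight_ge0 z : 0 <= joint_weight z.
Proof.
have /andP[p0 p1] := p01.
rewrite mulr_ge0 ?prodr_ge0// => i _; last exact: (row_weight_ge0 R).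
by case: ifP; rewrite ?subr_ge0.
Qed.

Lemma sum_joint_weight : \sum_z joint_weight z = 1.
Proof.
transitivity (Ex (fun z => \prod_(i < N) (fun _ _ _ => 1) i (z.1 i) (z.2 i))).
  by apply: eq_bigr => z _; rewrite big1_eq mulr1.
rewrite (expect_prod (fun _ _ _ => 1)) big1 // => i _.
under eq_bigr do rewrite mulr1.
by rewrite sum_row_weight // !mulr1 addrC subrK.
Qed.

Lemma joint_weight_neq0 z i : joint_weight z != 0 -> #|support_row (z.2 i)| = L.
Proof.
rewrite mulf_eq0 negb_or => /andP[_ /prodf_neq0 /(_ i isT)].
exact: (@row_weight_neq0 R).
Qed.

Lemma card_covered C X : (#|covered C X| <= M)%N.
Proof. by rewrite -[leqRHS]card_ord max_card. Qed.

(** [A] stays uncovered exactly when every positive row misses it, an event that factors over the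
    items. *)
Lemma expect_uncovered (A : {set 'I_M}) :
  Ex (fun z => [disjoint covered z.2 z.1 & A]%:R) =
  (p * rho (M - #|A|) + (1 - p)) ^+ N.
Proof.
transitivity (Ex (fun z => \prod_i
   (if z.1 i then [disjoint support_row (z.2 i) & A]%:R else 1))).
  apply: eq_expect => -[X C] /=.
  have [dis|/pred0Pn[a /andP[]]] := boolP [disjoint covered C X & A].
    rewrite big1 // => i _; case: ifP => // Xi.
    suff -> : [disjoint support_row (C i) & A] by [].
    apply: disjointWl dis; apply/fintype.subsetP => a; rewrite !inE => Cia.
    by apply/existsP; exists i; rewrite Cia.
  rewrite /= inE => /existsP[i /andP[Cia Xi]] aA.
  rewrite (bigD1 i) //= Xi; suff /negbTE-> : ~~ [disjoint support_row (C i) & A].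
    by rewrite mul0r.
  by apply/pred0Pn; exists a; rewrite /= inE Cia.
rewrite (expect_prod (fun i x s => if x then [disjoint support_row s & A]%:R else 1)) /=.
rewrite prodr_const card_ord sum_row_weight_disjoint //.
by under eq_bigr do rewrite mulr1; rewrite sum_row_weight // mulr1.
Qed.

Lemma draw_ratio_pred : (0 < M)%N -> rho M.-1 = 1 - L%:R / M%:R.
Proof.
move=> M0; have M0' : M%:R != 0 :> R by rewrite pnatr_eq0 -lt0n.
have C0 : ('C(M, L))%:R != 0 :> R by rewrite pnatr_eq0 -lt0n bin_gt0.
apply: (mulfI M0'); rewrite /draw_ratio mulrA -natrM mul_bin_down natrM.
by rewrite mulfK// natrB// mulrBr mulr1 mulrCA divff// mulr1.
Qed.

(** Negative correlation of drawing without replacement: [rho M.-1] and [rho M.-2] are the chances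
    that a row misses one, respectively two, given tests. *)
Lemma draw_ratio_pred2 : (0 < M)%N -> rho M.-2 <= rho M.-1 ^+ 2.
Proof.
move=> M0; have [M1|M1] := leqP M 1.
  (* For [M = 1] truncated subtraction makes both arguments 0, and the ratio is 0 or 1. *)
  have -> : M.-2 = M.-1 by lia.
  have -> : M.-1 = 0%N by lia.
  have -> : M = 1%N by lia.
  rewrite /draw_ratio bin0n; case: (L == 0)%N; last by rewrite mul0r expr0n.
  have [->|->] : ('C(1, L) = 1 \/ 'C(1, L) = 0)%N by case: (L) => [|[|l]]; auto.
    by rewrite divr1 expr1n.
  by rewrite invr0 mulr0 expr0n.
have M0' : M.-1%:R > 0 :> R by rewrite ltr0n; lia.
have e : (M.-1%:R : R) * rho M.-2 = (M.-1 - L)%N%:R * rho M.-1.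
  by rewrite /draw_ratio !mulrA -!natrM mul_bin_down.
rewrite -(ler_pM2l M0') e expr2 [leRHS]mulrA ler_wpM2r ?draw_ratio_ge0//.
rewrite draw_ratio_pred// mulrBr mulr1.
have [ML|ML] := leqP L M.-1; last first.
  have -> : (M.-1 - L = 0)%N by lia.
  rewrite subr_ge0 ler_piMr ?ler0n//.
  by rewrite ler_pdivrMr ?mul1r ?ler_nat ?ltr0n.
rewrite natrB// lerD2l lerN2 mulrCA ler_piMr ?ler0n//.
by rewrite ler_pdivrMr ?mul1r ?ler_nat ?ltr0n//; lia.
Qed.

Definition uncovered_mean : R := (1 - p * (L%:R / M%:R)) ^+ N.

(** Both terms are [N]-th powers. Negative correlation bounds the excess of the first base over the
    second by [p * (L / M) ^ 2], and telescoping multiplies this by [N]. *)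
Lemma uncovered_correlation : (0 < M)%N ->
  (p * rho M.-2 + (1 - p)) ^+ N - uncovered_mean ^+ 2 <=
  N%:R * p * (L%:R / M%:R) ^+ 2.
Proof.
move=> M0; have /andP[p0 p1] := p01.
have r0 : 0 <= L%:R / M%:R :> R by rewrite divr_ge0.
have r1 : L%:R / M%:R <= 1 :> R.
  by rewrite ler_pdivrMr ?mul1r ?ler_nat ?ltr0n.
rewrite /uncovered_mean exprAC.
have := draw_ratio_pred2 M0; rewrite draw_ratio_pred//.
have := draw_ratio_ge0 R M L M.-2.
move: (rho _) (_ / _) r0 r1 => x r r0 r1 x0 xr.
have d0 : 0 <= N%:R * p * r ^+ 2 by rewrite !mulr_ge0.
set y := p * x + _; set v := (1 - p * r) ^+ 2.
have pr : 0 <= 1 - p * r <= 1 by nra.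
have v01 : 0 <= v <= 1 by rewrite /v; nra.
have y01 : 0 <= y <= 1 by rewrite /y; nra.
have yv : y - v <= p * r ^+ 2 by rewrite /y /v; nra.
have [yv'|vy] := leP y v.
  by apply: le_trans d0; rewrite subr_le0 lerXn2r ?nnegrE//; lra.
apply: le_trans (ler_norm _) _.
rewrite -[in y ^+ N](card_ord N) -[in v ^+ N](card_ord N) -!prodr_const.
apply: le_trans (ler_dist_prod _ _ _ _) _ => //.
rewrite sumr_const card_ord -[leLHS]mulr_natl -[leRHS]mulrA ler_wpM2l//.
by rewrite gtr0_norm// subr_gt0.
Qed.

(** The uncovered fraction is an average of [M] indicators. The diagonal of the covariance double
    sum accounts for [1 / M]; the other entries are bounded by [uncovered_correlation]. *)
Lemma uncovered_variance : (0 < M)%N ->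
  Ex (fun z => ((M - #|covered z.2 z.1|)%N%:R / M%:R - uncovered_mean) ^+ 2) <=
  M%:R^-1 + N%:R * p * (L%:R / M%:R) ^+ 2.
Proof.
move=> M0; have /andP[p0 p1] := p01.
have M0' : M%:R != 0 :> R by rewrite pnatr_eq0 -lt0n.
set q := uncovered_mean; set d := N%:R * p * _.
have d0 : 0 <= d by rewrite !mulr_ge0 ?exprn_ge0 ?divr_ge0.
have r1 : L%:R / M%:R <= 1 :> R.
  by rewrite ler_pdivrMr ?mul1r ?ler_nat ?ltr0n.
have r0 : 0 <= L%:R / M%:R :> R by rewrite divr_ge0.
have q01 : 0 <= q <= 1 by rewrite exprn_ge0 ?exprn_ile1//; nra.
pose un (a : 'I_M) (z : config N * design N M) : R :=
  (a \notin covered z.2 z.1)%:R.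
have unE z : (M - #|covered z.2 z.1|)%N%:R / M%:R - q =
    M%:R^-1 * \sum_a (un a z - q).
  rewrite sumrB sumr_const card_ord -[q *+ M]mulr_natl mulrBr mulKf// mulrC.
  congr (_ * _ - _).
  have -> : (M - #|covered z.2 z.1| = #|~: covered z.2 z.1|)%N.
    by rewrite [in RHS]cardsCs setCK card_ord.
  rewrite -sum1_card natr_sum big_mkcond; apply: eq_bigr => a _.
  by rewrite inE /un; case: (a \in _).
have un1 a z : [disjoint covered z.2 z.1 & [set a]]%:R = un a z.
  by rewrite disjoint_sym disjoints1.
have Eun a : Ex (un a) = q.
  rewrite -(eq_expect _ (un1 a)) expect_uncovered cards1 subn1.
  by rewrite draw_ratio_pred// /q /uncovered_mean; congr (_ ^+ _); ring.
have Eun2 a b : a != b -> Ex (fun z => un a z * un b z) - q ^+ 2 <= d.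
  move=> ab; apply: le_trans (uncovered_correlation M0).
  rewrite lerD2r; have <- : (M - #|[set a; b]| = M.-2)%N by rewrite cards2 ab; lia.
  rewrite -expect_uncovered le_eqVlt; apply/orP; left; apply/eqP.
  apply: eq_expect => z; rewrite disjoint_sym disjoints_subset subUset.
  by rewrite !sub1set !in_setC /un -natrM mulnb.
have cov a b : Ex (fun z => (un a z - q) * (un b z - q)) <= (a == b)%:R + d.
  have -> : Ex (fun z => (un a z - q) * (un b z - q)) =
      Ex (fun z => un a z * un b z) - q ^+ 2.
    transitivity (Ex (fun z => un a z * un b z - q * un a z - q * un b z + q ^+ 2)).
      by apply: eq_expect => z; ring.
    rewrite expectD !expectB !expectZ !Eun expect_cst ?sum_joint_weight//.
    ring.
  have [<-|ab] := eqVneq a b; last by rewrite add0r Eun2.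
  apply: le_trans (_ : 1 <= _); last by rewrite lerDl.
  apply: le_trans (_ : Ex (un a) <= _); last by rewrite Eun; lra.
  rewrite lerBlDr (le_trans (_ : _ <= Ex (un a)))// ?lerDl ?sqr_ge0//.
  by apply: ler_expect joint_weight_ge0 _ _ _ => z _; rewrite /un;
    case: (_ \notin _); rewrite ?mulr1 ?mulr0.
have -> : Ex (fun z => ((M - #|covered z.2 z.1|)%N%:R / M%:R - q) ^+ 2) =
    M%:R^-1 ^+ 2 * \sum_a \sum_b Ex (fun z => (un a z - q) * (un b z - q)).
  under [in RHS]eq_bigr do rewrite -expect_sum.
  rewrite -expect_sum -expectZ; apply: eq_expect => z.
  rewrite unE exprMn expr2 [(\sum_a _) ^+ 2]expr2 mulr_suml; congr (_ * _).
  by apply: eq_bigr => a _; rewrite mulr_sumr.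
apply: le_trans (_ : M%:R^-1 ^+ 2 * \sum_(a < M) \sum_(b < M) ((a == b)%:R + d) <= _).
  by rewrite ler_wpM2l ?sqr_ge0// ler_sum// => a _; rewrite ler_sum.
under eq_bigr => a _.
  rewrite big_split /= sumr_const card_ord (bigD1 a)//= eqxx big1 => [|b].
    over.
  by rewrite eq_sym => /negbTE->.
rewrite sumr_const card_ord addr0 -[d *+ M]mulr_natr -[(_ + _) *+ M]mulr_natr.
rewrite le_eqVlt; apply/orP; left.
by apply/eqP; rewrite [true%:R]mulr1n; field.
Qed.
End Model.

Lemma prod_natr_bool (R : comPzRingType) (I : finType) (P b : pred I) :
  \prod_(i | P i) (b i)%:R = [forall (i | P i), b i]%:R :> R.
Proof.
have [/forallP h|/forallPn[i]] := boolP [forall (i | P i), b i].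
  by rewrite big1 // => i Pi; have := h i; rewrite Pi => /= ->.
by rewrite negb_imply => /andP[Pi /negbTE bi]; rewrite (bigD1 i)//= bi mul0r.
Qed.

(** * Undetermined items *)

Section Undetermined.
Variables (R : realType) (N M L : nat) (p : R).
Hypotheses (LM : (L <= M)%N) (p01 : 0 <= p <= 1).
Local Notation row := {ffun 'I_M -> bool}.
Local Notation u := (row_weight R L).
Local Notation rho := (draw_ratio R M L).
Local Notation Ex := (expect (@joint_weight R N M L p)).

Lemma expect_iter F :
  Ex F = \sum_(X : config N) mu p X * \sum_(C : design N M) PRP R L C * F (X, C).
Proof.
transitivity (\sum_(z : config N * design N M)
    joint_weight L p (z.1, z.2) * F (z.1, z.2)).
  by apply: eq_bigr => -[].
rewrite -(pair_bigA _ (fun X C => joint_weight L p (X, C) * F (X, C))) /=.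
apply: eq_bigr => X _; rewrite mulr_sumr; apply: eq_bigr => C _.
by rewrite /joint_weight /= mulrA.
Qed.

Lemma sure_zeroE (C : design N M) (X : config N) i :
  sure_zero C X i = ~~ (support_row (C i) \subset covered C X).
Proof.
apply/existsP/subsetPn => -[a].
  by move=> /andP[Cia na]; exists a; rewrite inE.
by rewrite !inE => Cia na; exists a; rewrite Cia.
Qed.

Lemma sure_zero_positive (C : design N M) (X : config N) i :
  X i -> sure_zero C X i = false.
Proof.
move=> Xi; apply/negbTE; rewrite sure_zeroE negbK.
apply/fintype.subsetP => a; rewrite !inE => Cia.
by apply/existsP; exists i; rewrite Cia.
Qed.

Lemma covered_mix (X : config N) (C D : design N M) :
  covered (mix (fun j => ~~ X j) C D) X = covered C X.
Proof.
apply/setP => a; rewrite !inE; apply: eq_existsb => j.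
by rewrite ffunE; case: (X j); rewrite ?andbF.
Qed.

(* Only the positive rows of [C] matter for [covered C X]: the rows of the
   negative items can be resampled from an independent copy [D]. *)
Lemma sum_PRP_mix (X : config N) (F : design N M -> R) :
  \sum_C PRP R L C * F C =
  \sum_C PRP R L C * \sum_D PRP R L D * F (mix (fun j => ~~ X j) C D).
Proof. exact: sum_prod_mix (sum_row_weight R LM). Qed.

(** After the negative rows are resampled, the covered set depends only on [C] while row [i] comes
    from [D], so the two are independent. *)
Lemma sum_PRP_U0 (X : config N) i :
  \sum_(C : design N M) PRP R L C * (i \in U0 C X)%:R =
  \sum_(C : design N M) PRP R L C * ((~~ X i)%:R * rho #|covered C X|).
Proof.
case Xi : (X i).
  by apply: eq_bigr => C _; rewrite inE Xi mul0r.
rewrite (sum_PRP_mix X); apply: eq_bigr => C _; congr (_ * _); rewrite mul1r.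
pose G (j : 'I_N) (s : row) : R :=
  if j == i then (support_row s \subset covered C X)%:R else 1.
transitivity (\sum_(D : design N M) PRP R L D * \prod_j G j (D j)).
  apply: eq_bigr => D _; congr (_ * _).
  rewrite /G -big_mkcond big_pred1_eq inE Xi sure_zeroE negbK covered_mix.
  by rewrite ffunE Xi.
rewrite sum_PRP_prod (bigD1 i)//= [X in _ * X]big1 => [|j /negbTE ji].
  by rewrite mulr1 /G eqxx sum_row_weight_sub.
by rewrite /G ji; under eq_bigr do rewrite mulr1; rewrite sum_row_weight.
Qed.

Lemma expect_U0 :
  Ex (fun z => #|U0 z.2 z.1|%:R) =
  Ex (fun z => #|[set i | ~~ z.1 i]|%:R * rho #|covered z.2 z.1|).
Proof.
have card_sum (A : {set 'I_N}) : #|A|%:R = \sum_i (i \in A)%:R :> R.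
  rewrite -sum1_card natr_sum big_mkcond; apply: eq_bigr => i _.
  by case: (i \in A).
rewrite !expect_iter; apply: eq_bigr => X _; congr (_ * _) => /=.
transitivity (\sum_i \sum_(C : design N M) PRP R L C * (i \in U0 C X)%:R).
  rewrite exchange_big; apply: eq_bigr => C _.
  by rewrite card_sum mulr_sumr.
under eq_bigr do rewrite sum_PRP_U0.
rewrite exchange_big; apply: eq_bigr => C _.
rewrite card_sum mulr_suml mulr_sumr; apply: eq_bigr => i _.
by rewrite inE.
Qed.

(* The event at item [j] that keeps every test of [B] decodable: a positive row
   must avoid [B], and [c] is the probability that a negative row does not block
   [B], i.e. does not meet [B] while lying inside the covered tests. *)
Definition clear_factor (B : {set 'I_M}) (X : config N) (C : design N M)
    (c : R) (j : 'I_N) : R :=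
  if X j then [disjoint support_row (C j) & B]%:R else c.

(** A positive item is unresolved when each test fails to decode it; the product of [1 - E a] over
    the tests is expanded over sets [B]. That all tests of [B] decode [i] is then a condition on
    each other item separately. *)
Lemma U1_inclusion_exclusion (X : config N) (C : design N M) i : X i ->
  (i \in U1 C X)%:R = \sum_(B : {set 'I_M}) (-1) ^+ #|B| *
    ((B \subset support_row (C i))%:R *
     \prod_(j | j != i) ((~~ [disjoint support_row (C j) & B]) ==>
        sure_zero C X j)%:R) :> R.
Proof.
move=> Xi; rewrite inE Xi /= /sure_one Xi /=.
pose E a := C i a && [forall j : 'I_N, ((j != i) && C j a) ==> sure_zero C X j].
transitivity (\prod_a (- (E a)%:R + 1) : R).
  case: (boolP [exists _, _]) => /= [/existsP[a Ea]|/existsPn nE].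
    by rewrite (bigD1 a)//= [E a]Ea addrC subrr mul0r.
  by rewrite big1 // => a _; rewrite /E (negbTE (nE a)) oppr0 add0r.
rewrite bigA_distr; apply: eq_bigr => B _.
transitivity (\prod_(a in B) (- (E a)%:R) : R); first by rewrite -big_mkcond.
under eq_bigr do rewrite -mulN1r.
rewrite big_split /= prodr_const; congr (_ * _).
rewrite !prod_natr_bool -natrM mulnb; congr (_%:R); congr nat_of_bool.
apply/forallP/andP => [h|[/fintype.subsetP Bi /forallP h] a].
  split; first by apply/fintype.subsetP => a aB; have := h a; rewrite aB inE => /andP[].
  apply/forallP => j; apply/implyP => ji; apply/implyP => /pred0Pn[a /andP[]].
  rewrite /= inE => Cja aB; have := h a; rewrite aB => /andP[_ /forallP/(_ j)].
  by rewrite ji Cja.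
apply/implyP => aB; rewrite /E; have := Bi a aB; rewrite inE => -> /=.
apply/forallP => j; apply/implyP => /andP[ji Cja].
have := h j; rewrite ji /= => /implyP; apply.
by apply/pred0Pn; exists a; rewrite /= inE Cja.
Qed.

(** Given the positive rows, the negative rows are fresh and their conditions are averaged one by
    one. A positive item is never a sure zero, so its row has to avoid [B]. *)
Lemma sum_PRP_clear (X : config N) (B : {set 'I_M}) i : X i ->
  \sum_(C : design N M) PRP R L C * ((B \subset support_row (C i))%:R *
     \prod_(j | j != i) ((~~ [disjoint support_row (C j) & B]) ==>
        sure_zero C X j)%:R) =
  \sum_(C : design N M) PRP R L C * ((B \subset support_row (C i))%:R *
     \prod_(j | j != i) clear_factor B X C
       (1 - (rho #|covered C X| - rho (#|covered C X| - #|B|))) j).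
Proof.
move=> Xi; rewrite (sum_PRP_mix X); apply: eq_bigr => C _; congr (_ * _).
have [BC|BC] := boolP (B \subset support_row (C i)); last first.
  by rewrite mul0r big1 // => D _; rewrite ffunE Xi (negbTE BC) mul0r mulr0.
(* Item [i] is positive, so all its tests, and with them [B], are covered; this is the inclusion
   used by [sum_row_weight_miss]. *)
rewrite mul1r; have BV : B \subset covered C X.
  apply: fintype.subset_trans BC _.
  by rewrite -[_ \subset _]negbK -sure_zeroE sure_zero_positive.
pose G (j : 'I_N) (s : row) : R :=
  if j != i then (if X j then [disjoint support_row (C j) & B]%:R
   else (~~ ((support_row s \subset covered C X) &&
             ~~ [disjoint support_row s & B]))%:R) else 1.
transitivity (\sum_(D : design N M) PRP R L D * \prod_j G j (D j)).
  apply: eq_bigr => D _; congr (_ * _); rewrite ffunE Xi BC mul1r big_mkcond.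
  apply: eq_bigr => j _; rewrite /G; case: ifP => // ji.
  case Xj : (X j).
    by rewrite sure_zero_positive// implybF negbK ffunE Xj.
  rewrite sure_zeroE covered_mix ffunE Xj /=.
  by case: (_ \subset _); case: [disjoint _ & _].
rewrite sum_PRP_prod [RHS]big_mkcond; apply: eq_bigr => j _.
rewrite /G /clear_factor; case: ifP => ji; last first.
  by under eq_bigr do rewrite mulr1; rewrite sum_row_weight.
case: ifP => Xj; last by rewrite sum_row_weight_miss.
by rewrite -mulr_suml sum_row_weight// mul1r.
Qed.

(** Probability that one item leaves a set of [k] tests decodable, when a negative row blocks it
    with probability [theta k]. *)
Definition clear_prob (theta : nat -> R) (k : nat) : R :=
  p * rho (M - k) + (1 - p) * (1 - theta k).

Lemma expect_clear (theta : nat -> R) (B : {set 'I_M}) i :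
  Ex (fun z => (z.1 i)%:R * ((B \subset support_row (z.2 i))%:R *
     \prod_(j | j != i) clear_factor B z.1 z.2 (1 - theta #|B|) j)) =
  p * (\sum_s u s * (B \subset support_row s)%:R) * clear_prob theta #|B| ^+ N.-1.
Proof.
pose G (j : 'I_N) (x : bool) (s : row) : R :=
  if j == i then x%:R * (B \subset support_row s)%:R
  else if x then [disjoint support_row s & B]%:R else 1 - theta #|B|.
transitivity (Ex (fun z => \prod_j G j (z.1 j) (z.2 j))).
  apply: eq_expect => z; rewrite [in RHS](bigD1 i)//= /G eqxx mulrA; congr (_ * _).
  by apply: eq_bigr => j /negbTE ->.
rewrite expect_prod (bigD1 i)//= /G eqxx; congr (_ * _).
  under eq_bigr do rewrite mul1r.
  under [X in _ + _ * X]eq_bigr do rewrite mul0r mulr0.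
  by rewrite big1_eq mulr0 addr0.
transitivity (\prod_(j < N | j != i) clear_prob theta #|B|).
  apply: eq_bigr => j /negbTE ->.
  rewrite sum_row_weight_disjoint// /clear_prob -mulr_suml.
  by rewrite sum_row_weight// mul1r.
rewrite prodr_const; congr (_ ^+ _).
by rewrite -[in RHS](card_ord N) -(cardC1 i).
Qed.

(* Replacing the random blocking probability by the constant [theta k] makes the
   product over the items factor exactly; [e] controls the replacement error. *)
Lemma expect_U1 (theta e : nat -> R) i :
  (forall k, (k <= L)%N -> 0 <= theta k <= 1) -> (forall v, 0 <= e v) ->
  (forall k v, (k <= L)%N -> (k <= v <= M)%N ->
     `|rho v - rho (v - k) - theta k| <= e v) ->
  `|Ex (fun z => (i \in U1 z.2 z.1)%:R) -
    p * \sum_(k < L.+1) ((-1) ^+ k * clear_prob theta k ^+ N.-1) *+ 'C(L, k)|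
  <= 2 ^+ L * (N%:R * Ex (fun z => e #|covered z.2 z.1|)).
Proof.
move=> theta01 e0 he.
pose A (B : {set 'I_M}) (z : config N * design N M) : R :=
  (-1) ^+ #|B| * ((z.1 i)%:R * ((B \subset support_row (z.2 i))%:R *
    \prod_(j | j != i) clear_factor B z.1 z.2
      (1 - (rho #|covered z.2 z.1| - rho (#|covered z.2 z.1| - #|B|))) j)).
pose A' (B : {set 'I_M}) (z : config N * design N M) : R :=
  (-1) ^+ #|B| * ((z.1 i)%:R * ((B \subset support_row (z.2 i))%:R *
    \prod_(j | j != i) clear_factor B z.1 z.2 (1 - theta #|B|) j)).
have -> : Ex (fun z => (i \in U1 z.2 z.1)%:R) =
    Ex (fun z => \sum_(B : {set 'I_M}) A B z).
  rewrite !expect_iter; apply: eq_bigr => X _; congr (_ * _) => /=.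
  case Xi : (X i); last first.
    apply: eq_bigr => C _; rewrite inE Xi /= big1 // => B _.
    by rewrite /A /= Xi mul0r mulr0.
  under eq_bigr do rewrite U1_inclusion_exclusion// mulr_sumr.
  under [RHS]eq_bigr do rewrite mulr_sumr.
  rewrite exchange_big [RHS]exchange_big; apply: eq_bigr => B _.
  under eq_bigr do rewrite mulrCA.
  under [RHS]eq_bigr do rewrite /A /= mulrCA Xi mul1r.
  by rewrite -!mulr_sumr sum_PRP_clear.
have -> : p * \sum_(k < L.+1) ((-1) ^+ k * clear_prob theta k ^+ N.-1) *+ 'C(L, k)
    = Ex (fun z => \sum_(B : {set 'I_M}) A' B z).
  rewrite expect_sum.
  under [RHS]eq_bigr do rewrite expectZ expect_clear -mulrA mulrCA.
  rewrite -mulr_sumr; congr (_ * _).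
  under [RHS]eq_bigr do rewrite mulrCA mulr_suml.
  (* Only rows with [L] ones carry weight, and all of them have the same alternating sum over their
     subsets, so the sum over [B] collapses to one over sizes with multiplicity ['C(L, k)]. *)
  rewrite exchange_big /= -[LHS]mul1r -[X in X * _ = _](sum_row_weight R LM) mulr_suml.
  apply: eq_bigr => s _.
  under [RHS]eq_bigr do rewrite -mulrA.
  rewrite -mulr_sumr.
  have [->|/row_weight_neq0 sL] := eqVneq (row_weight R L s) 0; first by rewrite !mul0r.
  congr (_ * _).
  have := sum_subset_by_card (support_row s)
    (fun k => (-1) ^+ k * clear_prob theta k ^+ N.-1); rewrite sL => <-.
  rewrite big_mkcond; apply: eq_bigr => B _.
  by case: (_ \subset _); rewrite ?mul1r ?mul0r.
rewrite -expectB; apply: le_trans (ler_norm_expect (@joint_weight_ge0 R N M L p p01) _) _.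
rewrite -2!expectZ; apply: ler_expect (@joint_weight_ge0 R N M L p p01) _ _ _ => z wz.
have zL := joint_weight_neq0 i wz.
rewrite -sumrB; apply: le_trans (ler_norm_sum _ _ _) _.
(* [2 ^ L] counts the subsets [B] of the support of row [i]; for each of them the replacement costs
   at most [e] per item. *)
apply: le_trans (_ : \sum_(B : {set 'I_M} | B \subset support_row (z.2 i))
   (N%:R * e #|covered z.2 z.1|) <= _); last first.
  rewrite sumr_const -zL -natrX -card_powerset [leRHS]mulr_natl.
  by rewrite (eq_card (_ : _ =i powerset (support_row (z.2 i)))) // => B; rewrite !inE.
rewrite [leRHS]big_mkcond; apply: ler_sum => B _.
rewrite /A /A' -mulrBr normrM normrX normrN1 expr1n mul1r -mulrBr.
case Xi : (z.1 i); last by rewrite mul0r normr0; case: ifP; rewrite ?mulr_ge0.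
rewrite mul1r -mulrBr.
have [BC|_] := boolP (B \subset _); last by rewrite mul0r normr0.
rewrite mul1r.
have BV : B \subset covered z.2 z.1.
  apply: fintype.subset_trans BC _.
  by rewrite -[_ \subset _]negbK -sure_zeroE sure_zero_positive.
have Bv : (#|B| <= #|covered z.2 z.1| <= M)%N.
  by rewrite subset_leq_card// card_covered.
have BL : (#|B| <= L)%N by rewrite -zL subset_leq_card.
have r0 := draw_ratio_ge0 R M L (#|covered z.2 z.1| - #|B|).
have r1 := draw_ratio_le1 R LM (card_covered z.2 z.1).
have r2 := leq_draw_ratio R M L (leq_subr #|B| #|covered z.2 z.1|).
have t01 := theta01 #|B| BL.
apply: le_trans (ler_dist_prod _ _ _ _) _.
- by move=> j; rewrite /clear_factor; case: ifP => _;
    [case: [disjoint _ & _]; rewrite lexx ler01|lra].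
- by move=> j; rewrite /clear_factor; case: ifP => _;
    [case: [disjoint _ & _]; rewrite lexx ler01|lra].
apply: le_trans (_ : \sum_(j < N) e #|covered z.2 z.1| <= _); last first.
  by rewrite sumr_const card_ord mulr_natl.
rewrite big_mkcond; apply: ler_sum => j _; case: ifP => // _.
rewrite /clear_factor; case: ifP => _; first by rewrite subrr normr0.
rewrite -normrN; apply: le_trans (he _ _ BL Bv).
by rewrite le_eqVlt; apply/orP; left; apply/eqP; congr (`|_|); ring.
Qed.

Lemma card_positives_mean : Ex (fun z => #|[set i | z.1 i]|%:R) = N%:R * p.
Proof.
transitivity (\sum_(i < N) Ex (fun z => (z.1 i)%:R)).
  rewrite -expect_sum; apply: eq_expect => z.
  rewrite -sum1_card natr_sum big_mkcond; apply: eq_bigr => i _.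
  by rewrite inE; case: (z.1 i).
transitivity (\sum_(i < N) p); last by rewrite sumr_const card_ord mulr_natl.
apply: eq_bigr => i _; pose G (j : 'I_N) (x : bool) (s : row) : R :=
  if j == i then x%:R else 1.
transitivity (Ex (fun z => \prod_j G j (z.1 j) (z.2 j))).
  by apply: eq_expect => z; rewrite /G -big_mkcond big_pred1_eq.
rewrite expect_prod (bigD1 i)//= /G eqxx -!mulr_suml sum_row_weight// !mul1r.
rewrite [true%:R]mulr1n [false%:R]mulr0n mulr1 mulr0 addr0 big1 ?mulr1 // => j /negbTE ->.
by rewrite -mulr_suml sum_row_weight// !mulr1 addrC subrK.
Qed.

Lemma expect_U1_bounds : 0 <= Ex (fun z => #|U1 z.2 z.1|%:R) <= N%:R * p.
Proof.
rewrite expect_ge0 => [/=||z]; [|exact: joint_weight_ge0|by rewrite ler0n].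
rewrite -card_positives_mean; apply: ler_expect (@joint_weight_ge0 R N M L p p01) _ _ _ => z _.
rewrite ler_nat subset_leq_card//; apply/fintype.subsetP => i.
by rewrite !inE => /andP[].
Qed.

End Undetermined.

(** * Estimates for ratios of binomial coefficients *)

Section DrawRatio.
Variable R : realType.
Local Notation rho := (draw_ratio R).

(** Drawing the tests one at a time: the next one lies in the given set with chance
    [(v - r) / (M - r)]. *)
Lemma draw_ratioS M r v : (r < M)%N ->
  rho M r.+1 v = rho M r v * ((v - r)%N%:R / (M - r)%N%:R).
Proof.
move=> rM; have nz k : k%:R != 0 :> R = (0 < k)%N by rewrite pnatr_eq0 lt0n.
have r0 : r.+1%:R != 0 :> R by rewrite nz.
have := mul_bin_left v r; have := mul_bin_left M r.
move=> /(congr1 (fun x : nat => x%:R : R)); rewrite !natrM => eM.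
move=> /(congr1 (fun x : nat => x%:R : R)); rewrite !natrM => ev.
have C0 : ('C(M, r))%:R != 0 :> R by rewrite nz bin_gt0 ltnW.
have Mr : (M - r)%N%:R != 0 :> R by rewrite nz subn_gt0.
rewrite /draw_ratio -(mulKf r0 ('C(v, r.+1)%:R)) ev -(mulKf r0 ('C(M, r.+1)%:R)) eM.
move: r0 C0 Mr {eM ev}.
move: (r.+1%:R : R) ('C(M, r)%:R : R) ((M - r)%N%:R : R) => a b c a0 b0 c0.
by field; rewrite a0 b0 c0.
Qed.

Lemma draw_factor_bounds M r v : (r < M)%N -> (v <= M)%N ->
  v%:R / M%:R - r%:R / M%:R <= ((v - r)%N%:R / (M - r)%N%:R : R) <= v%:R / M%:R.
Proof.
move=> rM vM; have M0 : 0 < M%:R :> R by rewrite ltr0n; lia.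
have Mr : 0 < (M - r)%N%:R :> R by rewrite ltr0n; lia.
have [vr|rv] := leqP v r.
  have -> : (v - r = 0)%N by lia.
  by rewrite mul0r divr_ge0// -mulrBl pmulr_lle0 ?invr_gt0// subr_le0 ler_nat vr.
rewrite ler_pdivlMr// ler_pdivrMr// -mulrBl -!mulrA ![_^-1 * _]mulrC !mulrA.
rewrite ler_pdivrMr// ler_pdivlMr// -!natrB//; last by lia.
by rewrite -!natrM !ler_nat; nia.
Qed.

Lemma draw_ratio_le_expn M r v : (r <= M)%N -> (v <= M)%N ->
  rho M r v <= (v%:R / M%:R) ^+ r.
Proof.
elim: r => [|r IH] rM vM; first by rewrite /draw_ratio !bin0 divff ?oner_eq0// expr0.
have /andP[_ h] := draw_factor_bounds rM vM.
rewrite draw_ratioS// exprSr ler_pM ?draw_ratio_ge0 ?divr_ge0 ?IH// ltnW//.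
Qed.

(** Each new factor differs from [nu] by at most the deviation of [v / M] plus the correction for
    drawing without replacement. The errors add up because all factors lie in [0,1]. *)
Lemma draw_ratio_approx M r v (nu : R) : (r <= M)%N -> (v <= M)%N ->
  0 <= nu <= 1 ->
  `|rho M r v - nu ^+ r| <= r%:R * (`|v%:R / M%:R - nu| + r%:R / M%:R).
Proof.
move=> + vM nu01; elim: r => [|r IH] rM.
  by rewrite /draw_ratio !bin0 divff ?oner_eq0// expr0 subrr normr0 mul0r.
rewrite draw_ratioS// exprSr.
have /andP[x1 x2] := draw_factor_bounds rM vM.
have r0 := draw_ratio_ge0 R M r v; have r1 := draw_ratio_le1 R (ltnW rM) vM.
have {}IH := IH (ltnW rM).
have vM1 : v%:R / M%:R <= 1 :> R.
  by rewrite ler_pdivrMr ?mul1r ?ler_nat// ltr0n; lia.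
set x := (_ / (M - r)%N%:R) in x1 x2 *.
have x0 : 0 <= x by rewrite divr_ge0.
have nur : 0 <= nu ^+ r <= 1 by rewrite exprn_ge0 ?exprn_ile1//; lra.
have -> : rho M r v * x - nu ^+ r * nu =
   (rho M r v - nu ^+ r) * x + nu ^+ r * (x - nu) by ring.
have rS : r%:R / M%:R <= r.+1%:R / M%:R :> R.
  by rewrite ler_wpM2r ?invr_ge0// ler_nat.
have xnu : `|x - nu| <= `|v%:R / M%:R - nu| + r.+1%:R / M%:R.
  have -> : x - nu = (v%:R / M%:R - nu) - (v%:R / M%:R - x) by ring.
  apply: le_trans (ler_normB _ _) _; rewrite lerD2l ger0_norm; lra.
apply: le_trans (ler_normD _ _) _; set b := `|v%:R / M%:R - nu| + _ in xnu *.
have -> : r.+1%:R * b = r%:R * b + b by rewrite -natr1; ring.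
apply: lerD.
  rewrite normrM (ger0_norm x0); apply: le_trans (ler_piMr _ _) _ => //.
    lra.
  apply: le_trans IH _; rewrite ler_wpM2l// lerD2l.
  exact: rS.
rewrite normrM ger0_norm; last lra.
by apply: le_trans xnu; rewrite ler_piMl//; lra.
Qed.

(** Pascal's rule telescoped over the [k] removed tests, with ['C(M, l.+1)] rewritten through
    ['C(M.-1, l)]. *)
Lemma draw_ratio_diff M l v k : (l < M)%N -> (k <= v)%N ->
  rho M l.+1 v - rho M l.+1 (v - k) =
  l.+1%:R / M%:R * \sum_(t < k) rho M.-1 l (v - t.+1).
Proof.
move=> lM; have M0 : M%:R != 0 :> R by rewrite pnatr_eq0; lia.
have l0 : l.+1%:R != 0 :> R by rewrite pnatr_eq0.
elim: k => [|k IH] kv; first by rewrite subn0 subrr big_ord0 mulr0.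
rewrite big_ord_recr /= mulrDr -IH; last lia.
suff -> : rho M l.+1 (v - k) =
    rho M l.+1 (v - k.+1) + l.+1%:R / M%:R * rho M.-1 l (v - k.+1) by ring.
have -> : (v - k = (v - k.+1).+1)%N by lia.
rewrite /draw_ratio binS natrD mulrDl; congr (_ + _).
have C0 : ('C(M.-1, l))%:R != 0 :> R by rewrite pnatr_eq0 -lt0n bin_gt0; lia.
have := mul_bin_diag M l; move=> /(congr1 (fun x : nat => x%:R : R)).
rewrite !natrM => eM.
rewrite -(mulKf l0 ('C(M, l.+1)%:R)) -eM.
move: l0 C0 M0 {eM}; move: (l.+1%:R : R) ('C(M.-1, l)%:R : R) (M%:R : R) => a b c a0 b0 c0.
by field; rewrite a0 b0 c0.
Qed.

(** Each of the [k] terms of [draw_ratio_diff] is close to [nu ^+ l]. The prefactor [1 / M] of the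
    error is what later absorbs the factor [N] in [expect_U1]. *)
Lemma draw_ratio_diff_approx M l v k (nu : R) : (l < M)%N -> (1 < M)%N ->
  (k <= l.+1)%N -> (k <= v <= M)%N -> 0 <= nu <= 1 ->
  `|rho M l.+1 v - rho M l.+1 (v - k) - k%:R * l.+1%:R / M%:R * nu ^+ l| <=
  l.+1%:R ^+ 3 / M%:R * (`|v%:R / M%:R - nu| + 4 * l.+1%:R / M%:R).
Proof.
move=> lM M1 kl /andP[kv vM] nu01.
have M0 : 0 < M%:R :> R by rewrite ltr0n; lia.
have M10 : 0 < M.-1%:R :> R by rewrite ltr0n; lia.
(* Passing from [M.-1] to [M] costs a factor 2. The constant 4 collects two errors of
   [2 * l.+1 / M]: one from [draw_ratio_approx], one from shifting [v - t.+1] back to [v]. *)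
have M2 : M.-1%:R^-1 <= 2 / M%:R :> R.
  rewrite ler_pdivlMr// mulrC ler_pdivrMr// -natrM ler_nat; lia.
rewrite draw_ratio_diff//.
have -> : k%:R * l.+1%:R / M%:R * nu ^+ l =
    l.+1%:R / M%:R * \sum_(t < k) nu ^+ l.
  by rewrite sumr_const card_ord -[nu ^+ l *+ k]mulr_natl; ring.
rewrite -mulrBr -sumrB normrM ger0_norm ?divr_ge0//.
set b := `|_| + _; have b0 : 0 <= b by rewrite addr_ge0 ?divr_ge0 ?mulr_ge0.
have -> : l.+1%:R ^+ 3 / M%:R * b = l.+1%:R / M%:R * (l.+1%:R * (l.+1%:R * b)) by ring.
rewrite ler_wpM2l ?divr_ge0//; apply: le_trans (ler_norm_sum _ _ _) _.
apply: le_trans (_ : \sum_(t < k) (l.+1%:R * b) <= _); last first.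
  by rewrite sumr_const card_ord -[leLHS]mulr_natl ler_wpM2r ?mulr_ge0// ler_nat.
apply: ler_sum => t _; have tk := ltn_ord t.
apply: le_trans (draw_ratio_approx _ _ nu01) _; [lia|lia|].
apply: ler_pM; [by []|by rewrite addr_ge0 ?divr_ge0|by rewrite ler_nat|].
have l2 : l%:R / M.-1%:R <= l.+1%:R * (2 / M%:R) :> R.
  by rewrite ler_pM ?invr_ge0// ler_nat.
have t2 : t.+1%:R / M.-1%:R <= l.+1%:R * (2 / M%:R) :> R.
  by rewrite ler_pM ?invr_ge0// ler_nat; lia.
have d : `|(v - t.+1)%N%:R / M.-1%:R - v%:R / M%:R| <= t.+1%:R / M.-1%:R :> R.
  have -> : (v - t.+1)%N%:R / M.-1%:R - v%:R / M%:R =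
      (v%:R / M%:R - t.+1%:R) / M.-1%:R :> R.
    have -> : v%:R / M%:R = v%:R / (M.-1%:R + 1) :> R.
      by rewrite natr1 prednK//; lia.
    rewrite natrB; last lia.
    by field; rewrite natr1 prednK ?gt_eqF//; lia.
  rewrite normrM (ger0_norm (_ : 0 <= M.-1%:R^-1)) ?invr_ge0// ler_wpM2r ?invr_ge0//.
  rewrite ler_norml; apply/andP; split.
    by have : 0 <= v%:R / M%:R :> R; [rewrite divr_ge0|lra].
  have : v%:R / M%:R <= 1 :> R by rewrite ler_pdivrMr// mul1r ler_nat.
  by rewrite -natr1; have := ler0n R t; lra.
rewrite /b; have := ler_normD ((v - t.+1)%N%:R / M.-1%:R - v%:R / M%:R) (v%:R / M%:R - nu).
rewrite addrA subrK.
have -> : 4 * l.+1%:R / M%:R = l.+1%:R * (2 / M%:R) + l.+1%:R * (2 / M%:R) :> R by ring.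
move: d l2 t2; lra.
Qed.
End DrawRatio.

(** * Limits at fixed prevalence *)

Section RealSequences.
Variable R : realType.
Implicit Types (f g h u : nat -> R) (l lambda : R).
Local Open Scope classical_set_scope.

Lemma near_cvg f g l : (\forall N \near \oo, f N = g N) ->
  g @ \oo --> l -> f @ \oo --> l.
Proof.
move=> fg gl; apply: cvg_trans gl; apply: near_eq_cvg.
by near=> N; apply/esym; near: N.
Unshelve. all: by end_near. Qed.

Lemma cvg_dist_squeeze f g h l :
  (\forall N \near \oo, `|f N - g N| <= h N) ->
  h @ \oo --> (0 : R) -> g @ \oo --> l -> f @ \oo --> l.
Proof.
move=> fgh h0 gl.
suff d0 : (fun N => f N - g N) @ \oo --> (0 : R).
  rewrite -[l]add0r; apply: near_cvg (cvgD d0 gl).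
  by near=> N; rewrite /= subrK.
apply: norm_cvg0; apply: (@squeeze_cvgr _ _ _ _ (fun=> 0) h) => //; last exact: cvg_cst.
by near=> N; rewrite normr_ge0 /=; near: N.
Unshelve. all: by end_near. Qed.

Lemma cvg_invn : (fun N : nat => N%:R^-1 : R) @ \oo --> (0 : R).
Proof.
apply/(gtr0_cvgV0 (f := fun N : nat => N%:R : R)); last exact: cvgr_idn.
by near=> N; rewrite ltr0n; near: N; exact: nbhs_infty_gt.
Unshelve. all: by end_near. Qed.

(** Above, [1 - x <= exp (- x)]; below, the same inequality for the exponential at [x / (1 - x)],
    since [1 / (1 - x) = 1 + x / (1 - x)]. *)
Lemma ler_one_sub_expn (x : R) n : 0 <= x < 1 ->
  expR (- (x * n%:R * (1 - x)^-1)) <= (1 - x) ^+ n <= expR (- (x * n%:R)).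
Proof.
move=> /andP[x0 x1]; have y0 : 0 < 1 - x by rewrite subr_gt0.
have -> : - (x * n%:R * (1 - x)^-1) = n%:R * - (x / (1 - x)) by ring.
have -> : - (x * n%:R) = n%:R * - x by ring.
rewrite !expRM_natl; apply/andP; split.
  apply: lerXn2r; rewrite ?nnegrE ?expR_ge0 ?(ltW y0)//.
  rewrite expRN invf_ple ?posrE ?expR_gt0//; apply: le_trans (expR_ge1Dx _).
  by rewrite le_eqVlt; apply/orP; left; apply/eqP; field; rewrite gt_eqF.
apply: lerXn2r; rewrite ?nnegrE ?expR_ge0 ?(ltW y0)//.
exact: expR_ge1Dx.
Qed.

(** The exponent is a separate sequence because both [N] (all items) and [N.-1] (all items but one)
    occur. *)
Lemma cvg_one_sub_expn u (m : nat -> nat) lambda :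
  (\forall N \near \oo, 0 <= u N) -> u @ \oo --> (0 : R) ->
  (fun N => u N * (m N)%:R) @ \oo --> lambda ->
  (fun N => (1 - u N) ^+ m N) @ \oo --> expR (- lambda).
Proof.
move=> u0 ucvg ulam.
apply: (@squeeze_cvgr _ _ _ _ (fun N => expR (- (u N * (m N)%:R * (1 - u N)^-1)))
   (fun N => expR (- (u N * (m N)%:R)))).
- near=> N; apply: ler_one_sub_expn; apply/andP; split; first by near: N.
  by near: N; exact: (cvgr_lt 0 ucvg 1 ltr01).
- apply: (@continuous_cvg _ _ _ _ _ (fun N => - (u N * (m N)%:R * (1 - u N)^-1)) expR).
    exact: continuous_expR.
  apply: cvgN; rewrite -[X in _ --> X]mulr1; apply: cvgM => //.
  rewrite -[X in _ --> X]invr1; apply: cvgV; first exact: oner_neq0.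
  by rewrite -[X in _ --> X]subr0; apply: cvgB => //; exact: cvg_cst.
- apply: (@continuous_cvg _ _ _ _ _ (fun N => - (u N * (m N)%:R)) expR).
    exact: continuous_expR.
  exact: cvgN.
Unshelve. all: by end_near. Qed.

Lemma cvg_scaled0 u lambda : (fun N => u N * N%:R) @ \oo --> lambda ->
  u @ \oo --> (0 : R).
Proof.
move=> ul; rewrite -(mulr0 lambda); apply: near_cvg (cvgM ul (@cvg_invn)).
near=> N; rewrite /= mulfK// pnatr_eq0 -lt0n.
by near: N; exact: nbhs_infty_gt.
Unshelve. all: by end_near. Qed.

Lemma cvg_scaled_pred u lambda : (fun N => u N * N%:R) @ \oo --> lambda ->
  (fun N => u N * N.-1%:R) @ \oo --> lambda.
Proof.
move=> ul; rewrite -[lambda]subr0; apply: near_cvg (cvgB ul (cvg_scaled0 ul)).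
near=> N.
have N0 : (0 < N)%N by near: N; exact: nbhs_infty_gt.
have eN : N%:R = N.-1%:R + 1 :> R by rewrite natr1 prednK.
transitivity (u N * N%:R - u N); last by [].
by rewrite eN; ring.
Unshelve. all: by end_near. Qed.

End RealSequences.

(** * Limits of the undetermined counts when the number of tests is proportional to [N] *)

Section FixedDensity.
Variables (R : realType) (p c : R) (L : nat) (M : nat -> nat).
Hypotheses (p01 : 0 <= p <= 1) (L0 : (0 < L)%N) (c0 : 0 < c).
Local Open Scope classical_set_scope.
Hypothesis Mc : (fun N => (M N)%:R / N%:R : R) @ \oo --> c.
Local Notation Ex N := (expect (@joint_weight R N (M N) L p)).

Lemma near_leM K : \forall N \near \oo, (K <= M N)%N.
Proof.
near=> N.
have N0 : (0 < N)%N by near: N; exact: nbhs_infty_gt.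
have h1 : c / 2 < (M N)%:R / N%:R.
  by near: N; apply: (cvgr_gt c Mc); rewrite ltr_pdivrMr// ltr_pMr// ltr1n.
have h2 : K%:R / (c / 2) <= N%:R by near: N; exact: cvgry_ge (@cvgr_idn R) _.
rewrite -(ler_nat R); move: h1 h2.
rewrite ltr_pdivlMr ?ltr0n// ler_pdivrMr ?divr_gt0// mulrC => h1 h2.
exact: le_trans h2 (ltW h1).
Unshelve. all: by end_near. Qed.

Lemma cvg_NM : (fun N => N%:R / (M N)%:R : R) @ \oo --> c^-1.
Proof.
apply: near_cvg (cvgV _ Mc); last by rewrite gt_eqF.
by near=> N; rewrite /= invf_div.
Unshelve. all: by end_near. Qed.

Lemma cvg_invM : (fun N => (M N)%:R^-1 : R) @ \oo --> (0 : R).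
Proof.
rewrite -(mulr0 c^-1); apply: near_cvg (cvgM cvg_NM (@cvg_invn R)).
near=> N; rewrite /= mulrC mulrA mulVf ?mul1r// pnatr_eq0 -lt0n.
by near: N; exact: nbhs_infty_gt.
Unshelve. all: by end_near. Qed.

Definition uncovered_limit : R := expR (- (p * L%:R / c)).
Local Notation w := uncovered_limit.

Lemma uncovered_limit_bounds : 0 <= w <= 1.
Proof.
have /andP[p0 _] := p01.
by rewrite expR_ge0 /= -[leRHS]expR0 ler_expR oppr_le0 divr_ge0 ?mulr_ge0// ltW.
Qed.

Lemma cvg_uncovered_mean :
  (fun N => @uncovered_mean R N (M N) L p) @ \oo --> w.
Proof.
have lim : (fun N => p * (L%:R / (M N)%:R) * N%:R) @ \oo --> p * L%:R / c.
  apply: near_cvg (cvgM (cvg_cst (p * L%:R)) cvg_NM).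
  by near=> N; rewrite /cst /=; ring.
apply: (@cvg_one_sub_expn R (fun N => p * (L%:R / (M N)%:R)) id) => //.
- have /andP[p0 _] := p01.
  by near=> N; rewrite mulr_ge0// divr_ge0.
- exact: cvg_scaled0 lim.
Unshelve. all: by end_near. Qed.

Definition mean_deviation N : R :=
  Ex N (fun z => `|#|covered z.2 z.1|%:R / (M N)%:R - (1 - w)|).

Lemma mean_deviation_ge0 N : 0 <= mean_deviation N.
Proof. by apply: expect_ge0 => // z; exact: joint_weight_ge0. Qed.

Lemma mean_deviation_cvg0 : mean_deviation @ \oo --> (0 : R).
Proof.
have /andP[p0 p1] := p01.
have vcvg : (fun N => (M N)%:R^-1 + N%:R * p * (L%:R / (M N)%:R) ^+ 2) @ \oo --> (0 : R).
  rewrite -[X in _ --> X](addr0 0); apply: cvgD; first exact: cvg_invM.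
  rewrite -(mulr0 (p * L%:R ^+ 2 * c^-1)).
  apply: near_cvg (cvgM (cvgM (cvg_cst (p * L%:R ^+ 2)) cvg_NM) cvg_invM).
  by near=> N; rewrite /cst /=; ring.
apply/cvgrPdist_le => /= eps eps0; near=> N.
(* One third of [eps] covers the gap between [q] and its limit [w]; the other two cover the terms of
   [expect_norm_le_sqr], once the variance is below [(eps / 3) ^ 2]. *)
have e0 : 0 < eps / 3 by rewrite divr_gt0.
rewrite sub0r normrN ger0_norm ?mean_deviation_ge0//.
have LM : (L <= M N)%N by near: N; exact: near_leM.
have M0 : (0 < M N)%N by exact: leq_trans LM.
have w0 := @joint_weight_ge0 R N (M N) L p p01.
have w1 := @sum_joint_weight R N (M N) L p LM.
set q := @uncovered_mean R N (M N) L p.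
have qw : `|q - w| <= eps / 3.
  rewrite distrC /q; near: N.
  by have /cvgrPdist_le := cvg_uncovered_mean; apply; rewrite divr_gt0.
pose F (z : config N * design N (M N)) : R :=
  (M N - #|covered z.2 z.1|)%N%:R / (M N)%:R - q.
apply: le_trans (_ : Ex N (fun z => `|F z| + `|q - w|) <= _).
  apply: ler_expect w0 _ _ _ => z _.
  apply: le_trans (ler_normD _ _); rewrite -normrN.
  rewrite le_eqVlt; apply/orP; left; apply/eqP; congr (`|_|).
  rewrite /F natrB ?card_covered//.
  by field; rewrite pnatr_eq0 -lt0n.
rewrite expectD expect_cst//.
have := expect_norm_le_sqr w0 w1 F e0.
have v : Ex N (fun z => F z ^+ 2) <= (eps / 3) ^+ 2.
  apply: le_trans (@uncovered_variance R N (M N) L p LM p01 M0) _.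
  apply: le_trans (ler_norm _) _; near: N.
  by have H := @cvgr0_norm_le _ _ _ _ _ _ vcvg; apply: H; rewrite exprn_gt0 ?divr_gt0.
have : (eps / 3)^-1 * Ex N (fun z => F z ^+ 2) <= eps / 3.
  by rewrite mulrC ler_pdivrMr// -expr2.
move: qw; lra.
Unshelve. all: by end_near. Qed.

Lemma card_zeros_mean N : (L <= M N)%N ->
  Ex N (fun z => #|[set i | ~~ z.1 i]%SET|%:R) = N%:R * (1 - p).
Proof.
move=> LM; rewrite mulrBr mulr1 -(@card_positives_mean R N (M N) L p LM).
rewrite -[X in X - _](@expect_cst _ _ _ (@sum_joint_weight R N (M N) L p LM) N%:R).
rewrite -expectB; apply: eq_expect => z.
have -> : [set i | ~~ z.1 i]%SET = (~: [set i | z.1 i])%SET by apply/setP => i; rewrite !inE.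
by rewrite cardsCs setCK card_ord natrB// -[leqRHS]card_ord max_card.
Qed.

(** By [expect_U0] and [draw_ratio_approx], replacing [rho] at the covered set by [(1 - w) ^ L]
    costs only [mean_deviation] and a term of order [1 / M]. *)
Lemma cvg_U0 : (fun N => Ex N (fun z => #|U0 z.2 z.1|%:R) / N%:R) @ \oo
  --> (1 - p) * (1 - w) ^+ L.
Proof.
have w01 := uncovered_limit_bounds.
apply: (@cvg_dist_squeeze R _ (fun=> (1 - p) * (1 - w) ^+ L)
  (fun N => L%:R * (mean_deviation N + L%:R / (M N)%:R))); last exact: cvg_cst.
  near=> N.
  have LM : (L <= M N)%N by near: N; exact: near_leM.
  have N0 : (0 < N)%N by near: N; exact: nbhs_infty_gt.
  have N0' : N%:R != 0 :> R by rewrite pnatr_eq0 -lt0n.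
  have w0 := @joint_weight_ge0 R N (M N) L p p01.
  have w1 := @sum_joint_weight R N (M N) L p LM.
  have -> : (1 - p) * (1 - w) ^+ L =
      Ex N (fun z => (1 - w) ^+ L * #|[set i | ~~ z.1 i]%SET|%:R) / N%:R.
    by rewrite expectZ card_zeros_mean//; field.
  rewrite expect_U0// -mulrBl -expectB normrM normfV normr_nat.
  rewrite ler_pdivrMr ?ltr0n//.
  apply: le_trans (ler_norm_expect w0 _) _.
  rewrite -[X in mean_deviation _ + X](expect_cst w1) /mean_deviation.
  rewrite -expectD -expectZ mulrC -expectZ.
  apply: ler_expect w0 _ _ _ => z _.
  rewrite [_ ^+ L * _]mulrC -mulrBr normrM normr_nat.
  apply: ler_pM => //; first by rewrite ler_nat -[leqRHS]card_ord max_card.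
  by apply: draw_ratio_approx; rewrite ?card_covered//; lra.
rewrite -(mulr0 L%:R); apply: cvgM; first exact: cvg_cst.
rewrite -[X in _ --> X](addr0 0); apply: cvgD; first exact: mean_deviation_cvg0.
by rewrite -(mulr0 L%:R); apply: cvgM; [exact: cvg_cst|exact: cvg_invM].
Unshelve. all: by end_near. Qed.

(** First-order value of [rho v - rho (v - k)] at [v / M = 1 - w]: the chance that a negative row
    meets [k] given covered tests and stays inside the covered set. *)
Definition blocking_prob N k : R := k%:R * L%:R / (M N)%:R * (1 - w) ^+ L.-1.

(** Limit of [N] times the probability that an item blocks [k] given tests; the summands come from
    positive and negative items. *)
Definition clear_rate (k : nat) : R :=
  p * (k%:R * L%:R / c) + (1 - p) * (k%:R * L%:R / c * (1 - w) ^+ L.-1).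

Lemma cvg_clear_prob k : (k <= L)%N ->
  (fun N => @clear_prob R (M N) L p (blocking_prob N) k ^+ N.-1) @ \oo
    --> expR (- clear_rate k).
Proof.
move=> kL; have /andP[p0 p1] := p01; have w01 := uncovered_limit_bounds.
pose x N : R := 1 - draw_ratio R (M N) L (M N - k).
pose u N : R := p * x N + (1 - p) * blocking_prob N k.
have bcvg : (fun N => k%:R * L%:R / (M N)%:R * N%:R) @ \oo --> k%:R * L%:R / c.
  apply: near_cvg (cvgM (cvg_cst (k%:R * L%:R : R)) cvg_NM).
  by near=> N; rewrite /cst /=; ring.
have xcvg : (fun N => x N * N%:R) @ \oo --> k%:R * L%:R / c.
  apply: cvg_dist_squeeze bcvg; last first.
    rewrite -(mulr0 (L%:R ^+ 3 * 4 * L%:R * c^-1)).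
    exact: (cvgM (cvgM (cvg_cst (L%:R ^+ 3 * 4 * L%:R : R)) cvg_NM) cvg_invM).
  near=> N; rewrite /cst /=.
  have LM : (L.+2 <= M N)%N by near: N; exact: near_leM.
  have M0 : (M N)%:R != 0 :> R by rewrite pnatr_eq0; lia.
  (* Taking [v = M] and [nu = 1] turns the difference estimate into one for [x N], the chance that a
     row meets [k] given tests. *)
  have := @draw_ratio_diff_approx R (M N) L.-1 (M N) k 1.
  rewrite prednK// expr1n mulr1 divff// subrr normr0 add0r.
  rewrite draw_ratio_full; last lia.
  move=> h; rewrite -mulrBl normrM normr_nat.
  apply: le_trans (ler_wpM2r _ (h _ _ _ _ _)) _ => //; [lia|lia|lia|by rewrite lexx ler01|].
  by rewrite le_eqVlt; apply/orP; left; apply/eqP; ring.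
have ucvg : (fun N => u N * N%:R) @ \oo --> clear_rate k.
  apply: near_cvg (cvgD (cvgM (cvg_cst p) xcvg)
    (cvgM (cvg_cst (1 - p)) (cvgM bcvg (cvg_cst ((1 - w) ^+ L.-1))))).
  near=> N; transitivity (p * (x N * N%:R) + (1 - p) *
    (k%:R * L%:R / (M N)%:R * N%:R * (1 - w) ^+ L.-1)); last by [].
  by rewrite /u /blocking_prob; ring.
apply: near_cvg (cvg_one_sub_expn _ (cvg_scaled0 ucvg) (cvg_scaled_pred ucvg)).
  by near=> N; congr (_ ^+ _); rewrite /clear_prob /u /x; ring.
near=> N; have LM : (L <= M N)%N by near: N; exact: near_leM.
have b0 : 0 <= blocking_prob N k.
  by rewrite mulr_ge0 ?divr_ge0 ?mulr_ge0 ?exprn_ge0 ?subr_ge0//; lra.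
have x0 : 0 <= x N by rewrite subr_ge0 (draw_ratio_le1 R LM)// leq_subr.
by apply: addr_ge0; apply: mulr_ge0 => //; rewrite subr_ge0.
Unshelve. all: by end_near. Qed.

Definition unsure_one_limit : R :=
  p * \sum_(k < L.+1) ((-1) ^+ k * expR (- clear_rate k)) *+ 'C(L, k).

(** The error left by [expect_U1] is a constant times [N / M] times [mean_deviation] plus a term of
    order [1 / M]; it vanishes because [N / M] converges. *)
Lemma cvg_U1 : (fun N => Ex N (fun z => #|U1 z.2 z.1|%:R) / N%:R) @ \oo
  --> unsure_one_limit.
Proof.
have w01 := uncovered_limit_bounds.
pose S N : R := p * \sum_(k < L.+1)
  ((-1) ^+ k * @clear_prob R (M N) L p (blocking_prob N) k ^+ N.-1) *+ 'C(L, k).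
pose h N : R := 2 ^+ L * L%:R ^+ 3 * (N%:R / (M N)%:R) *
  (mean_deviation N + 4 * L%:R * (M N)%:R^-1).
apply: (@cvg_dist_squeeze R _ S h).
- near=> N.
  have LM2 : (L.+2 <= M N)%N by near: N; exact: near_leM.
  have LM : (L <= M N)%N by lia.
  (* Makes [blocking_prob N k], which is at most [L * L / M] for [k <= L], a genuine probability. *)
  have L2M : (L * L <= M N)%N by near: N; exact: near_leM.
  have N0 : (0 < N)%N by near: N; exact: nbhs_infty_gt.
  have N0' : N%:R != 0 :> R by rewrite pnatr_eq0 -lt0n.
  have M0 : 0 < (M N)%:R :> R by rewrite ltr0n; lia.
  have w0 := @joint_weight_ge0 R N (M N) L p p01.
  have w1 := @sum_joint_weight R N (M N) L p LM.
  pose e (v : nat) : R := L%:R ^+ 3 / (M N)%:R *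
    (`|v%:R / (M N)%:R - (1 - w)| + 4 * L%:R / (M N)%:R).
  have he i := @expect_U1 R N (M N) L p LM p01 (blocking_prob N) e i.
  have Ee : Ex N (fun z => e #|covered z.2 z.1|) =
      L%:R ^+ 3 / (M N)%:R * (mean_deviation N + 4 * L%:R * (M N)%:R^-1).
    by rewrite /e expectZ expectD expect_cst.
  have -> : Ex N (fun z => #|U1 z.2 z.1|%:R) / N%:R - S N =
     (\sum_i (Ex N (fun z => (i \in U1 z.2 z.1)%:R) - S N)) / N%:R.
    rewrite sumrB sumr_const card_ord mulrBl -[S N *+ N]mulr_natr mulfK//.
    congr (_ / _ - _); rewrite -expect_sum; apply: eq_expect => z.
    rewrite -sum1_card natr_sum big_mkcond; apply: eq_bigr => i _.
    by case: (i \in _).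
  rewrite normrM normfV normr_nat ler_pdivrMr ?ltr0n//.
  apply: le_trans (ler_norm_sum _ _ _) _.
  have -> : h N * N%:R = \sum_(i < N) h N by rewrite sumr_const card_ord -[RHS]mulr_natr.
  apply: ler_sum => i _; rewrite /S.
  apply: le_trans (he i _ _ _) _.
  + move=> k kL; apply/andP; split.
      by rewrite mulr_ge0 ?divr_ge0 ?mulr_ge0 ?exprn_ge0 ?subr_ge0//; lra.
    apply: mulr_ile1; rewrite ?divr_ge0 ?mulr_ge0 ?exprn_ge0 ?exprn_ile1//; try lra.
    rewrite ler_pdivrMr// mul1r -natrM ler_nat; nia.
  + by move=> v; rewrite mulr_ge0 ?divr_ge0 ?exprn_ge0 ?addr_ge0 ?divr_ge0 ?mulr_ge0.
  + move=> k v kL kv; rewrite /blocking_prob /e.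
    have := @draw_ratio_diff_approx R (M N) L.-1 v k (1 - w).
    by rewrite prednK//; apply; [lia|lia|lia| |lra].
  rewrite Ee /h le_eqVlt; apply/orP; left; apply/eqP; ring.
- rewrite -(mulr0 (2 ^+ L * L%:R ^+ 3 * c^-1)); apply: cvgM.
    by apply: cvgM; [exact: cvg_cst|exact: cvg_NM].
  rewrite -[X in _ --> X](addr0 0); apply: cvgD; first exact: mean_deviation_cvg0.
  by rewrite -(mulr0 (4 * L%:R)); apply: cvgM; [exact: cvg_cst|exact: cvg_invM].
apply: cvgM; first exact: cvg_cst.
apply: cvg_big => [|k _]; first exact: add_continuous.
apply: cvgMn; apply: cvgM; first exact: cvg_cst.
by apply: cvg_clear_prob; rewrite -ltnS.
Unshelve. all: by end_near. Qed.

End FixedDensity.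

(** * Bounds on the average cost *)

Section AverageCost.
Variable R : realType.
Implicit Types (p : R) (N : nat).

Lemma avg_costE N p (L := Lbar p) (M := Mbar N p) : (L <= M)%N ->
  avg_cost N p = (M%:R +
    (expect (@joint_weight R N M L p) (fun z => #|U0 z.2 z.1|%:R) +
     expect (@joint_weight R N M L p) (fun z => #|U1 z.2 z.1|%:R)))
    / (N%:R * p * `|ln p|).
Proof.
move=> LM; rewrite /avg_cost -/L -/M -mulr_suml; congr (_ / _).
rewrite -expectD expect_iter.
rewrite (eq_bigr (fun C : design N M => PRP R L C * M%:R + \sum_(X : config N)
   PRP R L C * (mu p X * (#|U0 C X| + #|U1 C X|)%:R))) => [|C _]; last first.
  by rewrite /Tcost mulrDr mulr_sumr.
rewrite big_split /= -mulr_suml; congr (_ + _).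
  rewrite -[RHS]mul1r; congr (_ * _).
  rewrite -(bigA_distr_bigA (fun=> @row_weight R M L)) big1 // => i _.
  exact: sum_row_weight.
rewrite exchange_big; apply: eq_bigr => X _; rewrite mulr_sumr.
by apply: eq_bigr => C _; rewrite natrD mulrCA.
Qed.

(** * Non-asymptotic bounds for the prescribed [L] and [M] *)

Section Estimate.
Variables (N : nat) (p : R).
Hypotheses (p0 : 0 < p) (p2 : p < 2^-1) (Np : 6 <= N%:R * p).
Local Notation l := `|ln p|.
Local Notation L := (Lbar p).
Local Notation M := (Mbar N p).

Lemma ln2_bounds : 0 < ln (2 : R) < 1.
Proof.
rewrite ln_gt0 ?ltr1n//=; have e : 2 < expR 1 :> R.
  by have := @expR_gt1Dx R 1 (oner_neq0 _); lra.
by rewrite -[ltRHS](expRK 1) ltr_ln ?posrE ?expR_gt0.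
Qed.

Lemma expR_norm_ln : expR (- l) = p.
Proof.
rewrite ler0_norm ?opprK ?lnK// ln_le0//.
by rewrite (le_trans (ltW p2))// invf_le1 ?ler1n.
Qed.

Lemma ln2_lt_norm_ln : ln 2 < l.
Proof.
by rewrite -ltr_expR lnK ?posrE// -[expR l]invrK -expRN expR_norm_ln invf_pgt ?posrE.
Qed.

Lemma Lbar_bounds : L%:R * ln 2 <= l < (L%:R + 1) * ln 2.
Proof.
have /andP[l0 l1] := ln2_bounds.
have /andP[a b] := truncn_itv (divr_ge0 (normr_ge0 (ln p)) (ltW l0)).
by move: a b; rewrite ler_pdivlMr// ltr_pdivrMr// natr1 => -> ->.
Qed.

Lemma Lbar_gt0 : (0 < L)%N.
Proof.
have /andP[l0 l1] := ln2_bounds.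
by rewrite /Lbar truncn_gt0 ler_pdivlMr// mul1r ltW// ln2_lt_norm_ln.
Qed.

Lemma Mbar_bounds : M%:R <= N%:R * p * l / ln 2 ^+ 2 < M%:R + 1.
Proof.
have /andP[l0 _] := ln2_bounds; rewrite natr1; apply: truncn_itv.
by rewrite divr_ge0 ?exprn_ge0 ?mulr_ge0// ltW.
Qed.

(** Without rounding, [2 ^ (- |ln p| / ln 2) = p]; rounding [L] down loses at most a factor 2. *)
Lemma expr2_Lbar_bounds : p <= 2 ^- L <= 2 * p.
Proof.
have /andP[l0 l1] := ln2_bounds; have /andP[a b] := Lbar_bounds.
have e2 n : 2 ^- n = expR (- (n%:R * ln 2)) :> R.
  by rewrite expRN expRM_natl lnK ?posrE.
rewrite e2 -{1}expR_norm_ln ler_expR lerN2 a /=.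
have -> : - (L%:R * ln 2) = ln 2 + - ((L%:R + 1) * ln 2) :> R by ring.
rewrite expRD lnK ?posrE// ler_pM2l// -{2}expR_norm_ln ler_expR lerN2.
exact: ltW.
Qed.

(** Rounding down at most halves a number that is at least 2, which [6 <= N * p] ensures. *)
Lemma Mbar_ge_half : N%:R * p * l / ln 2 ^+ 2 <= 2 * M%:R.
Proof.
have /andP[l0 l1] := ln2_bounds; have /andP[a b] := Mbar_bounds.
have h := ln2_lt_norm_ln.
suff : 2 <= N%:R * p * l / ln 2 ^+ 2 by move: b; lra.
rewrite ler_pdivlMr ?exprn_gt0//.
have : 6 * ln 2 <= N%:R * p * l by apply: ler_pM => //; exact: ltW.
nra.
Qed.

(** The threshold 6 on [N * p] pays for the factor 2 lost in rounding [M] and for the 3, which turns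
    the error [3 / M] of [uncovered_mean_ge] into [1 / L]. *)
Lemma Mbar_ge_3Lbar : (3 * L <= M)%N.
Proof.
have /andP[l0 l1] := ln2_bounds; have /andP[a _] := Lbar_bounds.
rewrite -(ler_nat R) natrM -(@ler_pM2l _ 2)//; apply: le_trans Mbar_ge_half.
rewrite ler_pdivlMr ?exprn_gt0//.
have : 6 * l <= N%:R * p * l by rewrite ler_wpM2r.
have : L%:R * ln 2 * ln 2 <= l * 1 by apply: ler_pM => //; rewrite ?mulr_ge0// ltW.
nra.
Qed.

(** With [x = p * L / M], the choice of [L] and [M] keeps [N * x] below [ln 2 + O(1 / M)], so
    [(1 - x) ^ N] is at least [1/2 - O(1 / M)]. *)
Lemma uncovered_mean_ge : 2^-1 - (2 * L%:R)^-1 <= @uncovered_mean R N M L p.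
Proof.
have /andP[l0 l1] := ln2_bounds; have /andP[a _] := Lbar_bounds.
have L0 := Lbar_gt0; have LM := Mbar_ge_3Lbar.
have L0' : 1 <= L%:R :> R by rewrite ler1n.
have M1 : 3 * L%:R <= M%:R :> R by rewrite -natrM ler_nat.
have M0 : 0 < M%:R :> R by lra.
(* Combines [p <= 2 ^ (-L)] with [L <= 2 ^ (L - 1)]. *)
have pL : p * L%:R <= 2^-1.
  have /andP[h _] := expr2_Lbar_bounds.
  apply: le_trans (_ : 2 ^- L * L%:R <= _); first by rewrite ler_wpM2r.
  rewrite mulrC ler_pdivrMr ?exprn_gt0// mulrC ler_pdivlMr// -natrX -natrM ler_nat.
  by case: (L) L0 => // n _; rewrite expnS mulnC leq_mul2l /= ltn_expl.
set x := p * (L%:R / M%:R).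
have xM : x * M%:R = p * L%:R by rewrite /x; field; rewrite gt_eqF.
have x0 : 0 <= x by rewrite mulr_ge0 ?divr_ge0// ltW.
have x1 : x < 1 by rewrite -(ltr_pM2r M0) mul1r xM; lra.
have xN : x * N%:R * M%:R <= ln 2 * (M%:R + 1).
  rewrite mulrAC xM; have /andP[_ /ltW b] := Mbar_bounds.
  rewrite ler_pdivrMr ?exprn_gt0// in b.
  rewrite -(ler_pM2r l0); have : N%:R * p * (L%:R * ln 2) <= N%:R * p * l.
    by rewrite ler_wpM2l// (le_trans _ Np).
  by move: b; rewrite expr2; lra.
have /andP[h _] : expR (- (x * N%:R * (1 - x)^-1)) <= (1 - x) ^+ N <= expR (- (x * N%:R)).
  by apply: ler_one_sub_expn; rewrite x0.
apply: le_trans h.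
(* Since [x * M <= 1/2], the division by [1 - x] and the rounding of [M] together cost at most
   [3 / M]. *)
have ub : x * N%:R * (1 - x)^-1 <= ln 2 + 3 / M%:R.
  rewrite ler_pdivrMr ?subr_gt0// -(ler_pM2r M0); apply: le_trans xN _.
  rewrite mulrAC mulrDl [3 / _ * _]divfK ?gt_eqF//.
  have : x * (2 * M%:R) <= 1 by lra.
  nra.
apply: le_trans (_ : expR (- (ln 2 + 3 / M%:R)) <= _); last by rewrite ler_expR lerN2.
rewrite opprD expRD expRN lnK ?posrE//.
apply: le_trans (_ : 2^-1 * (1 + - (3 / M%:R)) <= _); last first.
  by rewrite ler_pM2l ?invr_gt0// expR_ge1Dx.
have : 3 / M%:R <= L%:R^-1 :> R.
  by rewrite ler_pdivrMr// mulrC ler_pdivlMr//; lra.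
rewrite invfM; lra.
Qed.

(** Chebyshev in pointwise form: on atypical outcomes the trivial bound 1 on [rho] is charged to the
    squared deviation, so [uncovered_variance] applies directly. *)
Lemma expect_draw_ratio_le :
  expect (@joint_weight R N M L p)
    (fun z => draw_ratio R M L #|covered z.2 z.1|) <=
  2 * expR 2 * p + 4 * L%:R ^+ 2 * (M%:R^-1 + N%:R * p * (L%:R / M%:R) ^+ 2).
Proof.
have LM3 := Mbar_ge_3Lbar; have L0 := Lbar_gt0.
have LM : (L <= M)%N by lia.
have M0 : (0 < M)%N by lia.
have p01 : 0 <= p <= 1.
  by rewrite ltW//= (le_trans (ltW p2))// invf_le1 ?ler1n.
have w0 := @joint_weight_ge0 R N M L p p01.
have w1 := @sum_joint_weight R N M L p LM.
have L1 : 1 <= L%:R :> R by rewrite ler1n.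
have L4 : 0 <= 4 * L%:R ^+ 2 :> R by rewrite mulr_ge0 ?exprn_ge0.
have q0 := uncovered_mean_ge; set q := uncovered_mean _ _ _ _ in q0.
apply: le_trans (_ : _ <= expect (@joint_weight R N M L p) (fun z =>
  2 * expR 2 * p + 4 * L%:R ^+ 2 *
    ((M - #|covered z.2 z.1|)%N%:R / M%:R - q) ^+ 2)) _; last first.
  by rewrite expectD expect_cst// expectZ lerD2l ler_wpM2l// uncovered_variance.
apply: ler_expect w0 _ _ _ => z _; set v := #|_|.
have vM : (v <= M)%N by exact: card_covered.
have vM1 : v%:R / M%:R <= 1 :> R by rewrite ler_pdivrMr ?ltr0n// mul1r ler_nat.
have v0 : 0 <= v%:R / M%:R :> R by rewrite divr_ge0.
apply: le_trans (draw_ratio_le_expn R LM vM) _.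
have -> : (M - v)%N%:R / M%:R = 1 - v%:R / M%:R :> R.
  by rewrite natrB// mulrBl divff// pnatr_eq0 -lt0n.
move: (v%:R / M%:R) v0 vM1 => x x0 x1.
have e0 : 0 <= 2 * expR 2 * p by rewrite !mulr_ge0 ?expR_ge0// ltW.
(* Typical case: [x ^ L <= 2 ^ (-L) * (1 + 2 / L) ^ L], at most [2 * p * exp 2]. *)
have [xs|xl] := leP x (2^-1 + L%:R^-1).
  apply: le_trans (_ : 2 * expR 2 * p <= _); last first.
    by rewrite lerDl mulr_ge0// sqr_ge0.
  apply: le_trans (_ : (2^-1 * (1 + 2 / L%:R)) ^+ L <= _).
    rewrite lerXn2r ?nnegrE// ?mulr_ge0 ?addr_ge0 ?divr_ge0//.
    by apply: le_trans xs _; lra.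
  rewrite exprMn exprVn mulrAC [_ * expR 2]mulrC mulrC.
  have /andP[_ h] := expr2_Lbar_bounds.
  have -> : expR 2 = expR (L%:R * (2 / L%:R)) :> R.
    by congr expR; field; rewrite gt_eqF//; lra.
  apply: ler_pM => //; rewrite ?exprn_ge0 ?addr_ge0 ?divr_ge0 ?invr_ge0//.
  rewrite expRM_natl lerXn2r ?nnegrE ?expR_ge0 ?addr_ge0 ?divr_ge0//.
  exact: expR_ge1Dx.
(* Atypical case: the uncovered fraction [1 - x] falls short of [q] by at least [1 / (2 * L)],
   whence the factor [4 * L ^ 2]. *)
apply: le_trans (_ : 1 <= _); first by rewrite exprn_ile1.
have i0 : 0 < L%:R^-1 :> R by rewrite invr_gt0; lra.
have : L%:R * L%:R^-1 = 1 :> R by rewrite divff// gt_eqF; lra.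
rewrite invfM in q0.
have : L%:R^-1 / 2 <= q - (1 - x) by lra.
move: (L%:R^-1) i0 => i i0 hq hi.
have : (L%:R * (i / 2)) ^+ 2 <= (L%:R * (q - (1 - x))) ^+ 2.
  by rewrite lerXn2r ?nnegrE ?mulr_ge0 ?ler_wpM2l//; lra.
rewrite mulrA hi; move: e0; nra.
Qed.

(** After division by [N * p * |ln p|], the typical part of [U0] and the bound [N * p] on [U1] give
    the first summand, and the variance part of [U0] gives the second. *)
Lemma avg_cost_bounds : 0 <= avg_cost N p - M%:R / (N%:R * p * l) <=
  (1 + 2 * expR 2) / l + (8 + 16 * l) / (N%:R * p ^+ 2).
Proof.
have /andP[l0 l1] := ln2_bounds; have l2 := ln2_lt_norm_ln.
have l3 : 0 < l by lra.
have LM3 := Mbar_ge_3Lbar; have L0 := Lbar_gt0.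
have LM : (L <= M)%N by lia.
have p01 : 0 <= p <= 1.
  by rewrite ltW//= (le_trans (ltW p2))// invf_le1 ?ler1n.
have w0 := @joint_weight_ge0 R N M L p p01.
have N0 : 0 < N%:R :> R by rewrite -(pmulr_lgt0 _ p0); apply: lt_le_trans Np.
have [p0' l0' l3' N0'] : [/\ 0 <= p, 0 <= ln (2 : R), 0 <= l & 0 <= N%:R :> R].
  by split; exact: ltW.
rewrite avg_costE// -mulrBl addrAC subrr add0r.
have /andP[u0 u1] := @expect_U1_bounds R N M L p LM p01.
set E0 := expect _ (fun z => #|U0 _ _|%:R); set E1 := expect _ _ in u0 u1 *.
have E00 : 0 <= E0 by apply: expect_ge0.
rewrite divr_ge0 ?mulr_ge0 ?addr_ge0 //=.
have E0le : E0 <= N%:R * (2 * expR 2 * p +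
    4 * L%:R ^+ 2 * (M%:R^-1 + N%:R * p * (L%:R / M%:R) ^+ 2)).
  apply: le_trans (_ : N%:R * expect (@joint_weight R N M L p)
    (fun z => draw_ratio R M L #|covered z.2 z.1|) <= _); last first.
    by rewrite ler_wpM2l// expect_draw_ratio_le.
  rewrite /E0 expect_U0// -expectZ; apply: ler_expect w0 _ _ _ => z _.
  rewrite ler_wpM2r ?draw_ratio_ge0// ler_nat -[leqRHS]card_ord; exact: max_card.
have M0 : 0 < M%:R :> R by rewrite ltr0n (leq_trans L0).
have /andP[Ll _] := Lbar_bounds.
have Mge : N%:R * p * l <= 2 * ln 2 ^+ 2 * M%:R.
  by have := Mbar_ge_half; rewrite ler_pdivrMr ?exprn_gt0//; lra.
(* From [L <= |ln p| / ln 2] and the lower bound on [M], the two variance terms become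
   [8 * l / (N * p)] and [16 * l ^ 2 / (N * p)]. *)
have key : 4 * L%:R ^+ 2 * (M%:R^-1 + N%:R * p * (L%:R / M%:R) ^+ 2) <=
    l * ((8 + 16 * l) / (N%:R * p)).
  have iM : M%:R^-1 <= 2 * ln 2 ^+ 2 / (N%:R * p * l).
    rewrite ler_pdivlMr ?mulr_gt0// mulrC ler_pdivrMr//.
  have LL : L%:R ^+ 2 <= l ^+ 2 / ln 2 ^+ 2.
    rewrite ler_pdivlMr ?exprn_gt0// -exprMn lerXn2r ?nnegrE ?mulr_ge0 //.
  have i0 : 0 <= M%:R^-1 :> R by rewrite invr_ge0 ltW.
  have iM2 : M%:R^-1 ^+ 2 <= (2 * ln 2 ^+ 2 / (N%:R * p * l)) ^+ 2.
    by rewrite lerXn2r ?nnegrE// (le_trans i0 iM).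
  have LL0 : 0 <= L%:R ^+ 2 :> R by rewrite exprn_ge0.
  apply: le_trans (_ : 4 * (l ^+ 2 / ln 2 ^+ 2) * (2 * ln 2 ^+ 2 / (N%:R * p * l) +
     N%:R * p * ((l ^+ 2 / ln 2 ^+ 2) * (2 * ln 2 ^+ 2 / (N%:R * p * l)) ^+ 2)) <= _).
    apply: ler_pM; rewrite ?mulr_ge0 ?addr_ge0 ?exprn_ge0 ?mulr_ge0 ?divr_ge0 //.
      by rewrite ler_wpM2l.
    apply: lerD => //; rewrite ler_wpM2l ?mulr_ge0 // exprMn.
    by apply: ler_pM; rewrite ?exprn_ge0.
  rewrite le_eqVlt; apply/orP; left; apply/eqP; field.
  by rewrite !gt_eqF.
rewrite ler_pdivrMr ?mulr_gt0//.
apply: le_trans (lerD E0le u1) _.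
apply: le_trans (_ : N%:R * (2 * expR 2 * p + l * ((8 + 16 * l) / (N%:R * p))) + N%:R * p <= _).
  by rewrite lerD2r ler_wpM2l // lerD2l.
rewrite le_eqVlt; apply/orP; left; apply/eqP; field.
by rewrite !gt_eqF.
Qed.

Lemma dist_Mbar : `|M%:R / (N%:R * p * l) - (ln 2 ^+ 2)^-1| <= l^-1.
Proof.
have /andP[l0 l1] := ln2_bounds; have l2 := ln2_lt_norm_ln.
have l3 : 0 < l by lra.
have N0 : 0 < N%:R :> R by rewrite -(pmulr_lgt0 _ p0); apply: lt_le_trans Np.
have D0 : 0 < N%:R * p * l by rewrite !mulr_gt0.
have /andP[a b] := Mbar_bounds.
have -> : M%:R / (N%:R * p * l) - (ln 2 ^+ 2)^-1 =
  - ((N%:R * p * l / ln 2 ^+ 2 - M%:R) / (N%:R * p * l)).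
  by field; rewrite !gt_eqF.
rewrite normrN ger0_norm ?divr_ge0 ?subr_ge0 ?(ltW D0)//.
rewrite ler_pdivrMr// mulrCA mulVf ?gt_eqF// mulr1.
by apply: le_trans (_ : 1 <= _); [lra|apply: le_trans Np; rewrite ler1n].
Qed.

End Estimate.
End AverageCost.

(** * The limits for [beta = 0] and for [beta > 0] *)

Section Limits.
Variable R : realType.
Local Open Scope classical_set_scope.

Lemma cvg_Mbar (p : R) : 0 < p ->
  (fun N => (Mbar N p)%:R / N%:R : R) @ \oo --> p * `|ln p| / ln 2 ^+ 2.
Proof.
move=> p0; apply: (@cvg_dist_squeeze R _ (fun=> p * `|ln p| / ln 2 ^+ 2) _ _ _ (@cvg_invn R));
  last exact: cvg_cst.
near=> N; have N0 : 0 < N%:R :> R.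
  by rewrite ltr0n; near: N; exact: nbhs_infty_gt.
have /andP[a b] := Mbar_bounds N p0.
rewrite -(ler_pM2r N0) mulVf ?gt_eqF// -[X in _ * X](gtr0_norm N0) -normrM.
rewrite mulrBl divfK ?gt_eqF// distrC.
have -> : p * `|ln p| / ln 2 ^+ 2 * N%:R = N%:R * p * `|ln p| / ln 2 ^+ 2 by ring.
by rewrite ger0_norm ?subr_ge0//; lra.
Unshelve. all: by end_near. Qed.

Definition fixed_p_limit (p : R) : R :=
  let L := Lbar p in let c := p * `|ln p| / ln 2 ^+ 2 in
  (c + ((1 - p) * (1 - uncovered_limit p c L) ^+ L + unsure_one_limit p c L)) /
  (p * `|ln p|).

Lemma cvg_avg_cost (p : R) : 0 < p -> p < 2^-1 ->
  (fun N : nat => avg_cost N p) @ \oo --> fixed_p_limit p.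
Proof.
move=> p0 p2; have l2 := ln2_lt_norm_ln p0 p2; have /andP[l0 _] := ln2_bounds R.
have l3 : 0 < `|ln p| by apply: lt_trans l2.
have p01 : 0 <= p <= 1.
  by rewrite ltW//= (le_trans (ltW p2))// invf_le1 ?ler1n.
have c0 : 0 < p * `|ln p| / ln 2 ^+ 2 by rewrite divr_gt0 ?mulr_gt0 ?exprn_gt0.
have L0 := Lbar_gt0 p0 p2; have Mc := cvg_Mbar p0.
rewrite /fixed_p_limit.
apply: near_cvg (cvgM (cvgD Mc (cvgD (cvg_U0 p01 L0 c0 Mc) (cvg_U1 p01 L0 c0 Mc)))
  (cvg_cst (p * `|ln p|)^-1)); near=> N.
have N0 : N%:R != 0 :> R.
  by rewrite pnatr_eq0 -lt0n; near: N; exact: nbhs_infty_gt.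
rewrite avg_costE; last by near: N; exact: near_leM c0 Mc _.
set m := (Mbar N p)%:R; set E0 := expect _ _; set E1 := expect _ _.
transitivity ((m / N%:R + (E0 / N%:R + E1 / N%:R)) * (p * `|ln p|)^-1); last by [].
by field; rewrite N0 !gt_eqF.
Unshelve. all: by end_near. Qed.

(** Obtained by letting [N] grow in [avg_cost_bounds], where the term in [1 / (N * p ^ 2)] vanishes
    at fixed [p]; this avoids estimating the alternating sum in the closed form. *)
Lemma fixed_p_limit_bounds (p : R) : 0 < p -> p < 2^-1 ->
  0 <= fixed_p_limit p - (ln 2 ^+ 2)^-1 <= (1 + 2 * expR 2) / `|ln p|.
Proof.
move=> p0 p2; have l2 := ln2_lt_norm_ln p0 p2; have /andP[l0 _] := ln2_bounds R.
have l3 : 0 < `|ln p| by apply: lt_trans l2.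
set l := `|ln p| in l2 l3 *.
have Np : \forall N \near \oo, 6 <= N%:R * p.
  near=> N; rewrite -ler_pdivrMr//; near: N; exact: cvgry_ge (@cvgr_idn R) _.
have lim : (fun N => avg_cost N p - (Mbar N p)%:R / (N%:R * p * l)) @ \oo -->
    fixed_p_limit p - (ln 2 ^+ 2)^-1.
  apply: cvgB; first exact: cvg_avg_cost.
  have -> : (ln 2 ^+ 2)^-1 = p * l / ln 2 ^+ 2 * (p * l)^-1 :> R.
    by field; rewrite !gt_eqF.
  apply: near_cvg (cvgM (cvg_Mbar p0) (cvg_cst (p * l)^-1)).
  by near=> N; rewrite -[N%:R * p * _]mulrA invfM mulrA.
have ub : (fun N : nat => (1 + 2 * expR 2) / l + (8 + 16 * l) / (N%:R * p ^+ 2)) @ \oo -->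
    (1 + 2 * expR 2) / l.
  rewrite -[X in _ --> X]addr0; apply: cvgD; first exact: cvg_cst.
  rewrite -(mulr0 ((8 + 16 * l) / p ^+ 2)).
  apply: near_cvg (cvgM (cvg_cst ((8 + 16 * l) / p ^+ 2)) (@cvg_invn R)).
  by near=> N; rewrite /cst /= invfM; ring.
apply/andP; split.
  rewrite -(cvg_lim _ lim)//; apply: limr_ge; first by apply/cvg_ex; eexists; exact: lim.
  near=> N; have Np' : 6 <= N%:R * p by near: N.
  by have /andP[] := avg_cost_bounds p0 p2 Np'.
rewrite -(cvg_lim _ lim)// -(cvg_lim _ ub)//.
apply: ler_lim; [by apply/cvg_ex; eexists; exact: lim|by apply/cvg_ex; eexists; exact: ub|].
near=> N; have Np' : 6 <= N%:R * p by near: N.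
by have /andP[] := avg_cost_bounds p0 p2 Np'.
Unshelve. all: by end_near. Qed.

Lemma fixed_p_limit_cvg : fixed_p_limit @ (0 : R)^'+ --> (ln (2 : R) ^+ 2)^-1.
Proof.
set K : R := 1 + 2 * expR 2; have K0 : 0 < K by rewrite addr_gt0 ?mulr_gt0 ?expR_gt0.
apply/cvgrPdist_le => /= eps eps0; near=> p.
have p0 : 0 < p by near: p; exact: nbhs_right_gt.
have p2 : p < 2^-1 by near: p; apply: nbhs_right_lt; rewrite invr_gt0.
(* Amounts to [|ln p| > K / eps]. *)
have pe : p < expR (- (K / eps)) by near: p; apply: nbhs_right_lt; exact: expR_gt0.
have /andP[a b] := fixed_p_limit_bounds p0 p2.
rewrite distrC ger0_norm//; apply: le_trans b _.
have l3 : 0 < `|ln p|.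
  by apply: lt_trans (ln2_lt_norm_ln p0 p2); have /andP[] := ln2_bounds R.
rewrite -/K ler_pdivrMr// [eps * _]mulrC -ler_pdivrMr//.
by move: pe; rewrite -{1}(expR_norm_ln p0 p2) ltr_expR ltrN2; exact: ltW.
Unshelve. all: by end_near. Qed.

Lemma near_ln_ge (A : R) : \forall N \near \oo, A <= ln (N%:R : R).
Proof.
near=> N; have h : expR A <= N%:R by near: N; exact: cvgry_ge (@cvgr_idn R) _.
by rewrite -[A]expRK ler_ln ?posrE ?expR_gt0// (lt_le_trans (expR_gt0 A)).
Unshelve. all: by end_near. Qed.

Lemma avg_cost_power_cvg (beta : R) : 0 < beta -> beta < 2^-1 ->
  (fun N : nat => avg_cost N ((N%:R : R) `^ (- beta))) @ \oo
    --> ((ln (2 : R)) ^+ 2)^-1.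
Proof.
move=> b0 b2; have /andP[l0 l1] := ln2_bounds R.
(* Here [N * p ^ 2 = N ^ gamma], and [gamma > 0] is the condition [beta < 1/2]. *)
pose gamma : R := 1 - 2 * beta; have g0 : 0 < gamma by rewrite /gamma; lra.
(* The total error will be [K / ln N]; in [2 + 2 * expR 2], one unit is the rounding error of
   [dist_Mbar]. *)
pose K : R := (2 + 2 * expR 2) / beta + (8 / ln 2 + 16) * (4 * beta / gamma ^+ 2).
have K0 : 0 < K.
  apply: addr_gt0; first by rewrite divr_gt0// addr_gt0// mulr_gt0// expR_gt0.
  by rewrite mulr_gt0 ?addr_gt0 ?divr_gt0 ?mulr_gt0 ?exprn_gt0.
apply/cvgrPdist_le => /= eps eps0; near=> N.
have N1 : (0 < N)%N by near: N; exact: nbhs_infty_gt.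
have N0 : 0 < N%:R :> R by rewrite ltr0n.
have t0 : 1 <= ln (N%:R : R) by near: N; exact: near_ln_ge.
(* These three thresholds yield in turn [p < 1/2], [6 <= N * p] and [K / ln N <= eps]. *)
have t1 : 1 / beta <= ln (N%:R : R) by near: N; exact: near_ln_ge.
have t2 : 5 / (1 - beta) <= ln (N%:R : R) by near: N; exact: near_ln_ge.
have t3 : K / eps <= ln (N%:R : R) by near: N; exact: near_ln_ge.
set t := ln (N%:R : R) in t0 t1 t2 t3.
have Nt : N%:R = expR t by rewrite lnK.
set p := N%:R `^ (- beta).
have pt : p = expR (- beta * t) by rewrite /p /powR gt_eqF.
have p0 : 0 < p by rewrite pt expR_gt0.
have bt : 1 <= beta * t by rewrite mulrC -ler_pdivrMr.
have p2 : p < 2^-1.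
  rewrite pt -[2]lnK ?posrE// -expRN ltr_expR; lra.
have lp : `|ln p| = beta * t by rewrite pt expRK mulNr normrN ger0_norm//; lra.
have Np : 6 <= N%:R * p.
  rewrite Nt pt -expRD; apply: le_trans (expR_ge1Dx _).
  move: t2; rewrite ler_pdivrMr; lra.
have /andP[a b] := avg_cost_bounds p0 p2 Np.
have d := dist_Mbar p0 p2 Np.
(* Growth quadratic in [t = ln N] suffices: divided into [|ln p| = beta * t], it leaves an error of
   order [1 / t]. *)
have Np2 : (gamma * t / 2) ^+ 2 <= N%:R * p ^+ 2.
  have -> : N%:R * p ^+ 2 = expR (gamma * t / 2) ^+ 2.
    by rewrite Nt pt -!expRM_natl -expRD; congr expR; rewrite /gamma; field.
  have h := expR_ge1Dx (gamma * t / 2).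
  have h0 : 0 <= gamma * t / 2 by rewrite divr_ge0 ?mulr_ge0//; lra.
  by rewrite lerXn2r ?nnegrE ?expR_ge0//; lra.
have main : (8 + 16 * `|ln p|) / (N%:R * p ^+ 2) <=
    (8 / ln 2 + 16) * (4 * beta / gamma ^+ 2) / t.
  have lnp := ln2_lt_norm_ln p0 p2.
  apply: le_trans (_ : (8 / ln 2 + 16) * `|ln p| / (N%:R * p ^+ 2) <= _).
    apply: ler_wpM2r; first by rewrite invr_ge0 mulr_ge0 ?exprn_ge0// ltW.
    rewrite [leRHS]mulrDl lerD2r.
    by rewrite mulrAC ler_pdivlMr// ler_pM2l// ltW.
  have c0 : 0 < 8 / ln 2 + 16 :> R by rewrite addr_gt0 ?divr_gt0.
  have r : `|ln p| / (N%:R * p ^+ 2) <= 4 * beta / gamma ^+ 2 / t.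
    rewrite ler_pdivrMr ?mulr_gt0 ?exprn_gt0// lp.
    apply: le_trans (_ : 4 * beta / gamma ^+ 2 / t * (gamma * t / 2) ^+ 2 <= _).
      by rewrite le_eqVlt; apply/orP; left; apply/eqP; field; rewrite !gt_eqF//; lra.
    have [b0' g0' t0'] : [/\ 0 <= beta, 0 <= gamma & 0 <= t] by split; lra.
    by apply: ler_wpM2l => //; rewrite !divr_ge0 ?mulr_ge0 ?exprn_ge0.
  by move: r; rewrite -(ler_pM2l c0) !mulrA.
have tK : K / t <= eps by rewrite ler_pdivrMr ?(lt_le_trans ltr01)// mulrC -ler_pdivrMr.
apply: le_trans tK.
have -> : K / t = (1 + 2 * expR 2) / `|ln p| + `|ln p|^-1 +
    (8 / ln 2 + 16) * (4 * beta / gamma ^+ 2) / t.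
  by rewrite /K lp; field; rewrite !gt_eqF//; lra.
rewrite distrC.
have -> : avg_cost N p - (ln 2 ^+ 2)^-1 =
  (avg_cost N p - (Mbar N p)%:R / (N%:R * p * `|ln p|)) +
  ((Mbar N p)%:R / (N%:R * p * `|ln p|) - (ln 2 ^+ 2)^-1) by ring.
apply: le_trans (ler_normD _ _) _; rewrite (ger0_norm a).
rewrite [leRHS]addrAC; apply: lerD => //.
by apply: le_trans b _; rewrite lerD2l.
Unshelve. all: by end_near. Qed.

End Limits.

Local Open Scope classical_set_scope.

Theorem theorem4 (R : realType) (beta : R) :
  0 <= beta -> beta < 2^-1 ->
  (0 < beta ->
     (fun N : nat => avg_cost N ((N%:R : R) `^ (- beta))) @ \oo
       --> ((ln (2 : R)) ^+ 2)^-1) /\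
  (beta = 0 ->
     exists g : R -> R,
       (\forall p \near 0^'+,
          (fun N : nat => avg_cost N p) @ \oo --> g p) /\
       (g @ 0^'+ --> ((ln (2 : R)) ^+ 2)^-1)).
Proof.
move=> _ b2; split=> [b0|_]; first exact: avg_cost_power_cvg.
exists (@fixed_p_limit R); split; last exact: fixed_p_limit_cvg.
near=> p; apply: cvg_avg_cost.
  by near: p; exact: nbhs_right_gt.
by near: p; apply: nbhs_right_lt; rewrite invr_gt0.
Unshelve. all: by end_near. Qed.
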